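(* Let $H$ be a connected graph on at least two vertices. Then the class $\operatorname{Ex}(H)$ of $H$-free graphs is pure if and only if $H$ is isomorphic to one of the complete graphs $K_2, K_3, K_4$ or to the path $P_3$ on three vertices.
   Context: Graphs are finite and simple. A graph $G$ contains $H$ as a minor if a graph isomorphic to $H$ can be obtained from a subgraph of $G$ by edge contractions (discarding loops and multiple edges). $G$ is $H$-free if it has no minor $H$; $\operatorname{Ex}(H)$ is the class of $H$-free graphs. An $H$-free graph is edge-maximal $H$-free if adding any edge between two non-adjacent vertices creates a graph with a minor $H$. For $H$ with at least one edge and $n\ge 1$, let $E_H(n)=\{e(G): G \text{ is an edge-maximal } H\text{-free graph on } n \text{ vertices}\}$, where $e(G)$ is the number of edges, and let $\operatorname{gap}_H(n)=\max E_H(n)-\min E_H(n)$. The class $\operatorname{Ex}(H)$ is pure if $\operatorname{gap}_H(n)=0$ for every $n\geq 1$. *)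

(* Defs.v *)
From mathcomp Require Import all_boot.
From mathcomp Require Import boolp classical_sets.

Set Implicit Arguments.
Unset Strict Implicit.
Unset Printing Implicit Defensive.

Record sgraph := SGraph {
  vertex :> finType;
  adj : rel vertex;
  adj_sym : symmetric adj;
  adj_irr : irreflexive adj }.

Definition iso (G K : sgraph) : Prop :=
  exists f : G -> K, bijective f /\ forall x y, adj (f x) (f y) = adj x y.

Definition connected (G : sgraph) : Prop :=
  forall x y : G, connect (@adj G) x y.

Definition edges (G : sgraph) : {set {set G}} :=
  [set [set p.1; p.2] | p : G * G & adj p.1 p.2].

Definition n_edges (G : sgraph) : nat := #|edges G|.

Section Complete.
Variable n : nat.
Definition complete_rel : rel 'I_n := fun i j => i != j.
Lemma complete_sym : symmetric complete_rel.
Proof. by move=> i j; rewrite /complete_rel eq_sym. Qed.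
Lemma complete_irr : irreflexive complete_rel.
Proof. by move=> i; rewrite /complete_rel eqxx. Qed.
Definition complete_graph := SGraph complete_sym complete_irr.
End Complete.

(* [path_graph n] has [n] vertices, hence [n - 1] edges. *)
Section Path.
Variable n : nat.
Definition path_rel : rel 'I_n :=
  fun i j => (j == i.+1 :> nat) || (i == j.+1 :> nat).
Lemma path_sym : symmetric path_rel.
Proof. by move=> i j; rewrite /path_rel orbC. Qed.
Lemma path_irr : irreflexive path_rel.
Proof. by move=> i; rewrite /path_rel orbb (ltn_eqF (ltnSn i)). Qed.
Definition path_graph := SGraph path_sym path_irr.
End Path.

Section AddEdge.
Variables (G : sgraph) (x y : G).
Definition add_edge_rel : rel G := fun u v =>
  adj u v || (u != v) && ([set u; v] == [set x; y]).
Lemma add_edge_sym : symmetric add_edge_rel.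
Proof. by move=> u v; rewrite /add_edge_rel adj_sym eq_sym (finset.setUC [set u]). Qed.
Lemma add_edge_irr : irreflexive add_edge_rel.
Proof. by move=> u; rewrite /add_edge_rel adj_irr eqxx. Qed.
Definition add_edge := SGraph add_edge_sym add_edge_irr.
End AddEdge.

(* [y] is merged into [x], which represents the new vertex; loops and
   multiple edges are discarded. *)
Section Contract.
Variables (G : sgraph) (x y : G).
Definition merge_vertex (u : G) : G := if u == y then x else u.
Definition contract_rel : rel {z : G | z != y} := fun a b =>
  (a != b) &&
  [exists u, exists v, [&& merge_vertex u == val a, merge_vertex v == val b & adj u v]].
Lemma contract_sym : symmetric contract_rel.
Proof.
move=> a b; rewrite /contract_rel eq_sym; congr (_ && _).
by apply/existsP/existsP => -[u /existsP[v /and3P[uP vP uv]]];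
  exists v; apply/existsP; exists u; rewrite uP vP adj_sym.
Qed.
Lemma contract_irr : irreflexive contract_rel.
Proof. by move=> a; rewrite /contract_rel eqxx. Qed.
Definition contract := SGraph contract_sym contract_irr.
End Contract.

Inductive contracts_to : sgraph -> sgraph -> Prop :=
| contracts_refl (G : sgraph) : contracts_to G G
| contracts_step (G : sgraph) (x y : G) (K : sgraph) :
    adj x y -> contracts_to (contract x y) K -> contracts_to G K.

(* [S] is isomorphic to a (not necessarily induced) subgraph of [G]. *)
Definition subgraph (S G : sgraph) : Prop :=
  exists f : S -> G, injective f /\ {homo f : x y / adj x y}.

Definition minor (H G : sgraph) : Prop :=
  exists S K : sgraph, [/\ subgraph S G, contracts_to S K & iso K H].

(* [Ex H G] : the graph [G] belongs to the class Ex(H). *)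
Definition Ex (H : sgraph) (G : sgraph) : Prop := ~ minor H G.

Definition edge_maximal (H G : sgraph) : Prop :=
  Ex H G /\ forall x y : G, x != y -> ~~ adj x y -> minor H (add_edge x y).

Definition E_ (H : sgraph) (n : nat) : set nat :=
  fun m => exists G : sgraph, [/\ #|G| = n, edge_maximal H G & n_edges G = m].

(* Both take the junk value 0 when no extremum exists; this does not happen
   for [E_ H n] with [H] having an edge, as this set is then finite and
   nonempty. *)
Definition max_set (A : set nat) : nat :=
  xget 0 (fun m => A m /\ forall k, A k -> k <= m).
Definition min_set (A : set nat) : nat :=
  xget 0 (fun m => A m /\ forall k, A k -> m <= k).

Definition gap (H : sgraph) (n : nat) : nat :=
  max_set (E_ H n) - min_set (E_ H n).

(* Purity of the class Ex(H). *)
Definition pure_Ex (H : sgraph) : Prop := forall n, 1 <= n -> gap H n = 0.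

(* Main.v *)
Require Import Defs.
From mathcomp Require Import all_boot.
From mathcomp Require boolp classical_sets.
From mathcomp Require Import zify.

Set Implicit Arguments.
Unset Strict Implicit.
Unset Printing Implicit Defensive.

(** Write [h] for the number of vertices of [H] and [d] for its least degree.
    Minors are handled through minor models [phi : G -> option H], whose
    fibres over [H] are the branch sets ([minorP]).  Every [H]-free graph
    extends to an edge-maximal one on the same vertices; so if Ex(H) is pure, a
    single edge-maximal graph bounds the number of edges of all [H]-free graphs
    on as many vertices ([pure_arcs]).  Most impure cases thus only ask for one
    edge-maximal graph and one [H]-free graph with more edges.

    Pure cases.  A nonempty graph of minimum degree at least [r - 1] contains
    [K_r] as a minor when [r <= 4]: a longest path, cut into suitable segments,
    provides the branch sets ([min_deg_minor]).  So an edge-maximal [K_r]-free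
    graph has a vertex [v] of degree at most [r - 2].  By maximality the
    neighbourhood of [v] is a clique, as large as possible, and the graph
    without [v] is again edge-maximal; induction gives the number of edges.
    Edge-maximal [P_3]-free graphs are matchings missing at most one vertex.

    Suppose that [H] is connected and not complete, with [d >= 2].  Attach to a
    clique of order [h - 1] some independent vertices, with pairwise distinct
    neighbourhoods of size [d - 1] in the clique.  The result is edge-maximal
    ([attach_edge_maximal]): each added edge gives a vertex, or a contractible
    pair of vertices, at least [d] neighbours in a clique of order [h - 1], and
    that is enough for [H] ([clique_minor]).  On the other hand let [c] be
    [2 d + 1 - h], or 0 if that is negative.  Two cliques of order [h - 1]
    sharing [c] vertices form an [H]-free graph ([two_cliques_free]), since two
    nonadjacent vertices of [H] of degree at least [d] have at least
    [2 d + 2 - h] common neighbours, and since [H] is connected when [c = 0].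
    It has more edges than the first graph.

    Suppose that [d = 1] and [h >= 4].  Disjoint unions of two cliques of order
    at most [h - 1], one of them of order exactly [h - 1], are edge-maximal.
    The edge counts that they impose on [2 h - 2] and on [2 h - 3] vertices
    forbid any connected [H]-free graph on [2 h - 2] vertices
    ([leaf_extremal]).  But a star is such a graph, unless [H] is itself a
    star.  In that case every graph on [h] vertices without a universal vertex
    is [H]-free, and such a graph can miss fewer edges than the union of
    [K_(h-1)] and an isolated vertex.

    For [K_r] with [r >= 5], the join of the Wagner graph with [K_(r-5)] is
    edge-maximal, with six edges fewer than the [K_r]-free graph formed by a
    clique of order [r - 1] and four attached vertices of degree [r - 2]. *)

(** * Minor models *)

Definition fibre_rel (G : sgraph) (T : eqType) (phi : G -> T) : rel G :=
  fun u v => adj u v && (phi u == phi v).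

(** The branch set of [h] is the fibre of [phi] over [Some h]; the vertices
    sent to [None] are the deleted ones. *)
Definition model (H G : sgraph) (phi : G -> option H) : Prop :=
  [/\ forall h, exists x, phi x = Some h,
      forall h x y, phi x = Some h -> phi y = Some h ->
        connect (fibre_rel phi) x y
    & forall h k, adj h k ->
        exists x y, [/\ phi x = Some h, phi y = Some k & adj x y]].

Lemma adj_neq (G : sgraph) (x y : G) : adj x y -> x != y.
Proof. by apply: contraTneq => ->; rewrite adj_irr. Qed.

Lemma connect_img (T T' : finType) (e : rel T) (e' : rel T') (f : T -> T') x y :
  (forall u v, e u v -> connect e' (f u) (f v)) ->
  connect e x y -> connect e' (f x) (f y).
Proof.
move=> ef /connectP[p]; elim: p x => [|z p IHp] x /=; first by move=> _ ->.
by case/andP=> exz zp yE; apply: connect_trans (ef _ _ exz) (IHp _ zp yE).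
Qed.

(** Used to replace a vertex by a neighbour in its own branch set. *)
Lemma fibre_step (G : sgraph) (T : eqType) (phi : G -> T) x y :
  x != y -> connect (fibre_rel phi) x y -> exists2 z, adj x z & phi z = phi x.
Proof.
move=> xy /connectP[[|z p] /=]; first by move=> _ yx; rewrite yx eqxx in xy.
by case/andP=> /andP[xz /eqP xzE] _ _; exists z.
Qed.

Lemma model_trans (A B C : sgraph) (phi : B -> option A) (psi : C -> option B) :
  model phi -> model psi -> model (fun x => obind phi (psi x)).
Proof.
move=> [phiS phiC phiA] [psiS psiC psiA].
have psiSb b : exists x, psi x == Some b by have [x xb] := psiS b; exists x; apply/eqP.
pose s b := xchoose (psiSb b).
have sP b : psi (s b) = Some b by apply/eqP/(xchooseP (psiSb b)).
pose E := fibre_rel (fun x => obind phi (psi x)).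
have sub x y : connect (fibre_rel psi) x y -> connect E x y.
  apply: connect_sub => u v /andP[uv /eqP e]; apply: connect1.
  by rewrite /E /fibre_rel uv e eqxx.
split.
- by move=> h; have [b bh] := phiS h; exists (s b); rewrite sP.
- move=> h x y.
  case xb: (psi x) => [b|] //= bh; case yb: (psi y) => [b'|] //= bh'.
  have bb' := phiC h b b' bh bh'.
  apply: connect_trans (sub _ _ (psiC b x (s b) xb (sP b))) _.
  apply: connect_trans (sub _ _ (psiC b' (s b') y (sP b') yb)).
  apply: connect_img bb' => u v /andP[uv /eqP uvE].
  have [x0 [y0 [x0u y0v x0y0]]] := psiA u v uv.
  apply: connect_trans (sub _ _ (psiC u (s u) x0 (sP u) x0u)) _.
  apply: connect_trans (sub _ _ (psiC v y0 (s v) y0v (sP v))).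
  by apply: connect1; rewrite /E /fibre_rel x0y0 x0u y0v /= uvE eqxx.
- move=> h k /phiA[b [c [bh ck bc]]]; have [x [y [xb yc xy]]] := psiA b c bc.
  by exists x, y; rewrite xb yc.
Qed.

Lemma model_id (G : sgraph) : model (@Some G).
Proof.
split; first by move=> h; exists h.
- by move=> h x y [->] [->]; apply: connect0.
- by move=> h k hk; exists h, k.
Qed.

Lemma model_subgraph (S G : sgraph) :
  subgraph S G -> exists phi : G -> option S, model phi.
Proof.
case=> f [f_inj f_hom]; exists (fun y => [pick x | f x == y]).
have fK x : [pick z | f z == f x] = Some x.
  by case: pickP => [z /eqP/f_inj-> //|/(_ x)]; rewrite eqxx.
have fP h x : [pick z | f z == x] = Some h -> x = f h.
  by case: pickP => // z /eqP zx [<-].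
split; first by move=> h; exists (f h).
- by move=> h x y /fP-> /fP->; apply: connect0.
- by move=> h k hk; exists (f h), (f k); split=> //; apply: f_hom.
Qed.

Lemma model_iso (K H : sgraph) : iso K H -> exists phi : K -> option H, model phi.
Proof.
case=> f [[g fK gK] f_adj]; exists (fun x => Some (f x)); split.
- by move=> h; exists (g h); rewrite gK.
- by move=> h x y [xh] [yh]; rewrite (can_inj fK (etrans xh (esym yh))) connect0.
- by move=> h k hk; exists (g h), (g k); rewrite !gK -f_adj !gK.
Qed.

Lemma model_contract (G : sgraph) (x y : G) :
  adj x y -> exists phi : G -> option (contract x y), model phi.
Proof.
move=> xy; have x_y := adj_neq xy.
have my z : merge_vertex x y z != y by rewrite /merge_vertex; case: ifPn.
exists (fun z => Some (Sub (merge_vertex x y z) (my z) : contract x y)).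
have m_id z : z != y -> merge_vertex x y z = z by rewrite /merge_vertex => /negbTE->.
split.
- case=> h hy; exists h; congr Some; apply: val_inj => /=; exact: m_id.
- move=> h u v [uh] [vh].
  have uv : merge_vertex x y u = merge_vertex x y v.
    by have := etrans uh (esym vh) => /(congr1 val).
  case: (eqVneq u v) => [->|u_v]; first exact: connect0.
  apply: connect1; rewrite /fibre_rel; apply/andP; split; last first.
    by apply/eqP; congr Some; apply: val_inj.
  move: uv u_v; rewrite /merge_vertex.
  case: (eqVneq u y) => [->|uy]; case: (eqVneq v y) => [->|vy].
  + by rewrite ?eqxx.
  + by move=> <- _; rewrite adj_sym.
  + by move=> ->.
  + by move=> ->; rewrite eqxx.
- move=> h k /andP[_ /existsP[u /existsP[v /and3P[/eqP uh /eqP vk uv]]]].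
  by exists u, v; split=> //; congr Some; apply: val_inj.
Qed.

Lemma model_contracts (G K : sgraph) :
  contracts_to G K -> exists phi : G -> option K, model phi.
Proof.
elim=> [{}G|{}G x y {}K xy _ [phi phiP]]; first by exists (@Some G); apply: model_id.
have [psi psiP] := model_contract xy.
by eexists; apply: model_trans phiP psiP.
Qed.

(** Contracting an edge inside a fibre lowers the number of vertices and
    keeps the hypotheses, so contractions can go on until [phi] is injective,
    that is, an isomorphism. *)
Lemma total_model_contracts (S H : sgraph) (phi : S -> H) :
  (forall h, exists x, phi x = h) ->
  (forall x y, phi x = phi y -> connect (fibre_rel phi) x y) ->
  (forall x y, adj x y -> phi x = phi y \/ adj (phi x) (phi y)) ->
  (forall h k, adj h k -> exists x y, [/\ phi x = h, phi y = k & adj x y]) ->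
  exists2 K, contracts_to S K & iso K H.
Proof.
have [n] := ubnP #|S|; elim: n S phi => // n IHn S phi leSn phiS phiC phiA phiE.
case: (boolP (injectiveb phi)) => [/injectiveP phi_inj|/injectivePn[x0 [y0 xy0 phi0]]].
  have phiSb h : exists x, phi x == h by have [x <-] := phiS h; exists x.
  exists S; first exact: contracts_refl.
  exists phi; split.
    exists (fun h => xchoose (phiSb h)).
      by move=> x; apply: phi_inj; apply/eqP/(xchooseP (phiSb (phi x))).
    by move=> h; apply/eqP/(xchooseP (phiSb h)).
  move=> x y; apply/idP/idP => [/phiE[x' [y' [/phi_inj-> /phi_inj->]]] //|xy].
  case: (phiA _ _ xy) => // /phi_inj xyE.
  by move: (adj_neq xy); rewrite xyE eqxx.
have [y xy yE] := fibre_step xy0 (phiC _ _ phi0).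
move: {xy0 phi0 y0} x0 xy yE => x xy yE.
have x_y := adj_neq xy.
have my z : merge_vertex x y z != y by rewrite /merge_vertex; case: ifPn.
have m_phi z : phi (merge_vertex x y z) = phi z.
  by rewrite /merge_vertex; case: eqP => // ->.
have m_id z : z != y -> merge_vertex x y z = z.
  by rewrite /merge_vertex => /negbTE->.
pose m z : contract x y := Sub (merge_vertex x y z) (my z).
have mK (z : contract x y) : m (val z) = z.
  by apply: val_inj; rewrite /= m_id //; apply: (valP z).
pose phi' (z : contract x y) := phi (val z).
have m_step u v : adj u v -> m u = m v \/ adj (m u) (m v).
  move=> uv; case: (eqVneq (m u) (m v)) => [|muv]; [by left | right].
  rewrite /adj /= /contract_rel muv /=.
  by apply/existsP; exists u; apply/existsP; exists v; rewrite !eqxx.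
have [|||||K cK iK] := IHn (contract x y) phi'; last 1 first.
- by exists K => //; apply: contracts_step cK.
- rewrite -ltnS; apply: leq_trans leSn; rewrite ltnS card_sig.
  by rewrite [X in _ < X](cardD1 y) add1n ltnS; apply/subset_leq_card/subsetP => z;
     rewrite !inE andbT.
- by move=> h; have [z zh] := phiS h; exists (m z); rewrite /phi' /= m_phi.
- move=> u v uv; rewrite -[u]mK -[v]mK.
  apply: (@connect_img _ _ _ _ m) (phiC _ _ uv) => a b /andP[ab /eqP abE].
  case: (m_step _ _ ab) => [->|mab]; first exact: connect0.
  by apply: connect1; rewrite /fibre_rel mab /phi' /= !m_phi abE eqxx.
- move=> u v /andP[_ /existsP[a /existsP[b /and3P[/eqP au /eqP bv ab]]]].
  by rewrite /phi' -au -bv !m_phi; apply: phiA.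
- move=> h k hk; have [a [b [ah bk ab]]] := phiE h k hk.
  exists (m a), (m b); rewrite /phi' /= !m_phi; split=> //.
  case: (m_step _ _ ab) => // /(congr1 phi'); rewrite /phi' /= !m_phi ah bk => hkE.
  by move: (adj_neq hk); rewrite hkE eqxx.
Qed.

Section ModelSubgraph.
Variables (H G : sgraph) (phi : G -> option H).

(** Edges between branch sets that are not adjacent in [H] are dropped, so that
    contracting the branch sets produces [H] itself. *)
Definition model_edge (u v : {x : G | phi x}) : bool :=
  adj (val u) (val v) &&
  ((phi (val u) == phi (val v)) ||
   [exists h, exists k,
     [&& phi (val u) == Some h, phi (val v) == Some k & adj h k]]).

Lemma model_edge_sym : symmetric model_edge.
Proof.
move=> u v; rewrite /model_edge adj_sym eq_sym; congr (_ && (_ || _)).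
by apply/existsP/existsP => -[h /existsP[k /and3P[hu kv hk]]];
  exists k; apply/existsP; exists h; rewrite hu kv adj_sym.
Qed.

Lemma model_edge_irr : irreflexive model_edge.
Proof. by move=> u; rewrite /model_edge adj_irr. Qed.

Definition model_subgraph_of := SGraph model_edge_sym model_edge_irr.
End ModelSubgraph.

Theorem minorP (H G : sgraph) :
  minor H G <-> exists phi : G -> option H, model phi.
Proof.
split=> [[S [K [SG SK KH]]]|[phi [phiS phiC phiA]]].
  have [a aP] := model_subgraph SG; have [b bP] := model_contracts SK.
  have [c cP] := model_iso KH.
  by eexists; apply: model_trans (model_trans cP bP) aP.
pose S := model_subgraph_of phi.
have psiP (x : S) : exists h, phi (val x) == Some h.
  by case: x => x /=; case: (phi x) => // h _; exists h.
pose psi (x : S) := xchoose (psiP x).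
have psiE x : phi (val x) = Some (psi x) by apply/eqP/(xchooseP (psiP x)).
have lift x h : phi x = Some h -> exists2 u : S, val u = x & psi u = h.
  move=> xh; have xT : phi x by rewrite xh.
  exists (Sub x xT) => //; have := psiE (Sub x xT); rewrite /= xh.
  by case.
have [||||K SK KH] := @total_model_contracts S H psi.
- by move=> h; have [x /lift[u _ <-]] := phiS h; exists u.
- move=> u v uv.
  have uh := psiE u; have vh := psiE v; rewrite -uv in vh.
  have /connectP[p] := phiC _ _ _ uh vh.
  elim: p u uv uh vh => [|z p IHp] u uv uh vh /=.
    by move=> _ /val_inj->; apply: connect0.
  case/andP=> /andP[uz /eqP uzE] zp last_v.
  have zh : phi z = Some (psi u) by rewrite -uzE.
  have [w wz wu] := lift z _ (zh).
  apply: (@connect_trans _ _ w).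
    apply: connect1; rewrite /fibre_rel wu eqxx andbT /= /model_edge wz uz.
    by rewrite uzE eqxx.
  by apply: IHp; rewrite ?wz ?wu ?zh.
- move=> u v /andP[uv /orP[/eqP|/existsP[h /existsP[k /and3P[/eqP uh /eqP vk hk]]]]].
    by rewrite !psiE => -[->]; left.
  by right; move: uh vk; rewrite !psiE => -[->] [->].
- move=> h k hk; have [x [y [xh yk xy]]] := phiA h k hk.
  have [u ux uh] := lift x _ xh; have [v vy vk] := lift y _ yk.
  exists u, v; split=> //; rewrite /= /model_edge ux vy xy /=.
  apply/orP; right; apply/existsP; exists h; apply/existsP; exists k.
  by rewrite xh yk !eqxx.
exists S, K; split=> //.
by exists val; split; [apply: val_inj | move=> u v /andP[]].
Qed.

Lemma card_cover (H : sgraph) (T : finType) (f : T -> option H) (A : {set H}) :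
  (forall h, h \in A -> exists t, f t = Some h) -> #|A| <= #|T|.
Proof.
move=> fA; rewrite -(card_imset A Some_inj) -cardsT.
apply: leq_trans (leq_imset_card f _); apply/subset_leq_card/subsetP => o.
by case/imsetP=> h /fA[t <-] ->; rewrite imset_f.
Qed.

(** * Counting edges *)

Definition deg (G : sgraph) (x : G) := #|[set y | adj x y]|.
Definition arcs (G : sgraph) := \sum_(x : G) deg x.

Lemma degE (G : sgraph) (x : G) : deg x = \sum_y adj x y.
Proof.
rewrite /deg -sum1_card big_mkcond /=.
by apply: eq_bigr => y _; rewrite inE; case: adj.
Qed.

Lemma arcs_edges (G : sgraph) : arcs G = (n_edges G).*2.
Proof.
transitivity (\sum_(p in [set p : G * G | adj p.1 p.2]) 1).
  rewrite big_mkcond /= /arcs (eq_bigr _ (fun x _ => degE x)) pair_big /=.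
  by apply: eq_bigr => p _; rewrite inE; case: adj.
rewrite (partition_big_imset (fun p : G * G => [set p.1; p.2])) /=.
have -> : [set [set p.1; p.2] | p in [set p : G * G | adj p.1 p.2]] = edges G.
  by apply: eq_imset => // p; rewrite !inE.
rewrite -muln2 -sum_nat_const; apply: eq_bigr => e /imsetP[[a b]].
rewrite inE /= => ab ->; have a_b := adj_neq ab.
rewrite sum1dep_card (_ : [set _ | _] = [set (a, b); (b, a)]).
  by rewrite cards2 xpair_eqE (negbTE a_b).
apply/setP => -[c d]; rewrite !inE !xpair_eqE /=.
apply/andP/orP => [[cd /eqP cdE]|[] /andP[/eqP-> /eqP->]]; last first.
- by rewrite adj_sym ab setUC.
- by rewrite ab.
have c_d := adj_neq cd.
have: c \in [set a; b] by rewrite -cdE !inE eqxx.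
have: d \in [set a; b] by rewrite -cdE !inE eqxx orbT.
rewrite !inE => /orP[] /eqP dE /orP[] /eqP cE; subst c d;
  rewrite ?eqxx in c_d *; by [left | right].
Qed.

Lemma sub_arcs (T : finType) (r r' : rel T) rs ri r's r'i :
  subrel r r' -> arcs (@SGraph T r rs ri) <= arcs (@SGraph T r' r's r'i).
Proof.
move=> rr'; apply: leq_sum => x _; apply/subset_leq_card/subsetP => y.
by rewrite !inE; apply: rr'.
Qed.

Lemma add_edge_arcs (G : sgraph) (x y : G) :
  x != y -> ~~ adj x y -> arcs G < arcs (add_edge x y).
Proof.
move=> xy nxy; rewrite /arcs /= (bigD1 x) //= [X in _ < X](bigD1 x) //=.
rewrite -addSn leq_add //.
  apply: proper_card; apply/properP; split.
    by apply/subsetP => z; rewrite !inE /= /add_edge_rel => ->.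
  by exists y; rewrite !inE //= /add_edge_rel xy eqxx orbT.
apply: leq_sum => z _; apply/subset_leq_card/subsetP => t.
by rewrite !inE /= /add_edge_rel => ->.
Qed.

Lemma deg_lt (G : sgraph) (x : G) : deg x < #|G|.
Proof.
apply: (@leq_trans #|[set: G]|); last by rewrite cardsT.
by apply/proper_card/properP; split=> //; exists x; rewrite ?inE ?adj_irr.
Qed.

Lemma arcs_le (G : sgraph) : arcs G <= #|G| * #|G|.
Proof. by rewrite -sum_nat_const leq_sum // => x _; apply/ltnW/deg_lt. Qed.

(** * Purity in terms of edge-maximal graphs *)

Lemma minor_subgraph (H G G' : sgraph) : subgraph G G' -> minor H G -> minor H G'.
Proof.
move=> /model_subgraph[a aP] /minorP[b bP]; apply/minorP.
by eexists; apply: model_trans bP aP.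
Qed.

Lemma subgraph_minor (H G : sgraph) : subgraph H G -> minor H G.
Proof. by move=> /model_subgraph HG; apply/minorP. Qed.

Lemma edge_maximal_ext (H G : sgraph) : ~ minor H G ->
  exists (r : rel G) (rs : symmetric r) (ri : irreflexive r),
    subrel (@adj G) r /\ edge_maximal H (SGraph rs ri).
Proof.
have [n] := ubnP (#|G| * #|G| - arcs G); elim: n G => // n IHn G leG HG.
case: (boolp.pselect (exists x y : G,
    [/\ x != y, ~~ adj x y & ~ minor H (add_edge x y)])); last first.
  move=> Gmax; exists (@adj G), (@adj_sym G), (@adj_irr G); split=> //.
  split; first by case: (G) HG.
  move=> x y xy nxy; apply: boolp.contrapT => nm; case: Gmax; exists x, y.
  by split=> //; case: (G) x y xy nxy nm.
case=> x [y [xy nxy nm]].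
have [|r [rs [ri [sub mx]]]] := IHn (add_edge x y) _ nm.
  have cE : #|add_edge x y| = #|G| by [].
  move: leG (add_edge_arcs xy nxy) (arcs_le (add_edge x y)); rewrite cE; lia.
by exists r, rs, ri; split=> // u v uv; apply: sub; rewrite /= /add_edge_rel uv.
Qed.

(** The set of edge numbers is bounded, so its extrema are attained as soon as
    it is nonempty; if it is empty, both default values are 0. *)
Theorem pureP (H : sgraph) :
  pure_Ex H <-> forall G1 G2 : sgraph, 0 < #|G1| -> #|G1| = #|G2| ->
    edge_maximal H G1 -> edge_maximal H G2 -> n_edges G1 = n_edges G2.
Proof.
split=> [pureH G1 G2 n_gt0 cardE G1max G2max|uniqE n n_gt0].
  pose n := #|G1|; pose A := E_ H n.
  have [A1 A2] : A (n_edges G1) /\ A (n_edges G2).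
    by split; [exists G1 | exists G2].
  have Ab m : A m -> m <= n * n.
    case=> G [Gn _ <-]; rewrite /n -/n -Gn; apply: leq_trans (arcs_le G).
    by rewrite arcs_edges -addnn leq_addr.
  pose p m : bool := boolp.asbool (A m).
  have exp : exists m, p m by exists (n_edges G1); apply/boolp.asboolP.
  have pb m : p m -> m <= n * n by move/boolp.asboolP/Ab.
  have maxP : A (max_set A) /\ forall k, A k -> k <= max_set A.
    apply: (@classical_sets.xgetPex _ 0 (fun m => A m /\ forall k, A k -> k <= m)).
    case: (ex_maxnP exp pb) => m /boolp.asboolP Am m_max.
    by exists m; split=> // k Ak; apply: m_max; apply/boolp.asboolP.
  have minP : A (min_set A) /\ forall k, A k -> min_set A <= k.
    apply: (@classical_sets.xgetPex _ 0 (fun m => A m /\ forall k, A k -> m <= k)).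
    case: (ex_minnP exp) => m /boolp.asboolP Am m_min.
    by exists m; split=> // k Ak; apply: m_min; apply/boolp.asboolP.
  have := pureH n n_gt0; rewrite /gap -/A.
  case: maxP minP => _ maxP [_ minP].
  have := maxP _ A1; have := maxP _ A2; have := minP _ A1; have := minP _ A2.
  by lia.
rewrite /gap; apply/eqP; rewrite subn_eq0.
rewrite /max_set /min_set.
case: classical_sets.xgetP => [m _ [[G1 [c1 max1 <-]] _]|_] //.
case: classical_sets.xgetP => [k _ [[G2 [c2 max2 <-]] _]|nmin].
  by rewrite (uniqE G1 G2) // ?c1 ?c2.
case: (nmin (n_edges G1)); split; first by exists G1.
by move=> k [G2 [c2 max2 <-]]; rewrite (uniqE G1 G2) // ?c1 ?c2.
Qed.

(** [G'] extends to an edge-maximal graph, which has as many edges as [G]. *)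
Lemma pure_arcs (H G G' : sgraph) : pure_Ex H -> 0 < #|G| -> #|G| = #|G'| ->
  edge_maximal H G -> ~ minor H G' -> arcs G' <= arcs G.
Proof.
move=> /pureP pureH n0 cE Gmax /edge_maximal_ext[r [rs [ri [sub rmax]]]].
rewrite [X in _ <= X]arcs_edges (pureH _ _ n0 _ Gmax rmax) // -arcs_edges.
by case: G' r rs ri sub {cE rmax} => T e es ei r rs ri sub; apply: sub_arcs.
Qed.

Lemma pure_iff (H H' : sgraph) :
  (forall G, minor H G <-> minor H' G) -> pure_Ex H <-> pure_Ex H'.
Proof.
move=> HH'; have maxE G : edge_maximal H G <-> edge_maximal H' G.
  split=> -[HG Hmax]; split; rewrite /Ex.
  - by move=> /HH'.
  - by move=> x y xy nxy; apply/HH'/Hmax.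
  - by move=> /HH'.
  - by move=> x y xy nxy; apply/HH'/Hmax.
split=> /pureP pureH; apply/pureP => G1 G2 n0 cE /maxE G1m /maxE G2m;
  exact: pureH.
Qed.

Lemma iso_minor (H H' G : sgraph) : iso H H' -> minor H G <-> minor H' G.
Proof.
move=> HH'; have [a aP] := model_iso HH'.
have [b bP] : exists b : H' -> option H, model b.
  apply: model_iso; case: HH' => f [[g fK gK] f_adj]; exists g.
  by split; [exists f | move=> x y; rewrite -f_adj !gK].
by split=> /minorP[c cP]; apply/minorP; eexists;
   [apply: model_trans aP cP | apply: model_trans bP cP].
Qed.

(** * Deleting a vertex *)

Section DelVertex.
Variables (G : sgraph) (v : G).
Definition del_rel : rel {x : G | x != v} := fun x y => adj (val x) (val y).
Lemma del_sym : symmetric del_rel.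
Proof. by move=> x y; apply: adj_sym. Qed.
Lemma del_irr : irreflexive del_rel.
Proof. by move=> x; apply: adj_irr. Qed.
Definition del_vertex := SGraph del_sym del_irr.

Lemma del_subgraph : subgraph del_vertex G.
Proof. by exists val; split; first exact: val_inj. Qed.

Lemma card_del : #|del_vertex| = #|G|.-1.
Proof.
rewrite card_sig -[#|G|]cardsT [X in X.-1](cardD1 v) inE add1n /=.
by apply: eq_card => x; rewrite !inE andbT.
Qed.

Lemma sum_del (F : G -> nat) :
  \sum_(x : del_vertex) F (val x) = \sum_(x | x != v) F x.
Proof.
rewrite [RHS](reindex_omap (op := addn) (val : del_vertex -> G) insub) /=; last first.
  by move=> x xv; rewrite insubT.
by apply: eq_bigl => x; rewrite (valP x) valK eqxx.
Qed.

Lemma deg_del (x : del_vertex) : deg x + adj (val x) v = deg (val x).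
Proof. by rewrite !degE [RHS](bigD1 v) //= addnC -(sum_del (fun y => adj (val x) y)). Qed.

Lemma arcs_del : arcs del_vertex + (deg v).*2 = arcs G.
Proof.
rewrite /arcs [RHS](bigD1 v) //= -(sum_del (@deg G)) -addnn addnCA; congr (_ + _).
rewrite {1}degE (bigD1 v) //= adj_irr add0n.
rewrite -(sum_del (fun x => adj v x : nat)) -big_split /=.
by apply: eq_bigr => x _; rewrite -deg_del adj_sym.
Qed.

(** A neighbour of [v] in the same branch set can take over the role of [v],
    because it sees all other neighbours of [v]. *)
Lemma simplicial_minor (H : sgraph) :
  (forall a b : G, adj v a -> adj v b -> a != b -> adj a b) ->
  (forall h : H, deg v < deg h) ->
  minor H G -> minor H del_vertex.
Proof.
move=> clq degH /minorP[phi [phiS phiC phiA]]; apply/minorP.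
have [[h0 _]|H0] := boolp.pselect (exists h : H, True); last first.
  by exists (fun=> None); split=> h; case: H0; exists h.
have [u uP] : exists u : del_vertex, forall h, phi v = Some h ->
    adj v (val u) /\ phi (val u) = Some h.
  case vE: (phi v) => [h|]; last first.
    have [x xh] := phiS h0; have xv : x != v by apply: contra_eq_neq vE => <-; rewrite xh.
    by exists (Sub x xv).
  suff [z vz zh] : exists2 z, adj v z & phi z = Some h.
    have zv : z != v by rewrite eq_sym adj_neq.
    by exists (Sub z zv) => _ [<-].
  (* otherwise the branch set of [h] is [v] alone, of too small a degree *)
  apply: boolp.contrapT => noz; have := degH h; rewrite ltnNge => /negP; apply.
  have vh x : phi x = Some h -> x = v.
    move=> xh; apply/eqP; apply/negPn/negP => xv; apply: noz.
    rewrite eq_sym in xv.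
    by have [z vz zh] := fibre_step xv (phiC h _ _ vE xh); exists z; rewrite // zh.
  rewrite /deg -(card_imset [set y | adj h y] Some_inj).
  apply: leq_trans (leq_imset_card phi _); apply/subset_leq_card/subsetP => k'.
  case/imsetP=> k; rewrite inE => hk ->.
  have [x [y [/vh-> yk vy]]] := phiA h k hk.
  by rewrite -yk imset_f // inE.
pose r x : del_vertex := insubd u x.
have rK x : r (val x) = x by apply: valKd.
have rphi x h : phi x = Some h -> phi (val (r x)) = Some h.
  by rewrite val_insubd; case: eqP => //= -> /uP[].
have r_id x : x != v -> val (r x) = x by move=> xv; rewrite val_insubd xv.
have r_v : r v = u by apply: val_inj; rewrite val_insubd eqxx.
have rV y h : adj v y -> phi v = Some h -> r y = u \/ adj u (r y).
  move=> vy /uP[vu _]; case: (eqVneq (r y) u) => [|ryu]; [by left | right].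
  have yv : y != v by rewrite eq_sym adj_neq.
  rewrite /= /del_rel /= r_id //; apply: clq => //.
  by apply: contra_neq ryu => yu; apply: val_inj; rewrite /= r_id.
have rA x y h k : adj x y -> phi x = Some h -> phi y = Some k ->
    r x = r y \/ adj (r x) (r y).
  case: (eqVneq x v) => [->|xv]; case: (eqVneq y v) => [->|yv] xy xh yk.
  - by left.
  - by rewrite r_v; case: (rV y h xy xh) => [->|]; [left | right].
  - rewrite r_v; rewrite adj_sym in xy.
    by case: (rV x k xy yk) => [->|]; [left | rewrite adj_sym; right].
  - by right; rewrite /= /del_rel !r_id.
exists (fun x => phi (val x)); split.
- by move=> h; have [x xh] := phiS h; exists (r x); apply: rphi.
- move=> h x y xh yh; rewrite -[x]rK -[y]rK.
  have /connectP[p] := phiC h _ _ xh yh.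
  elim: p (val x) xh => [|z p IHp] w wh /=; first by move=> _ ->; apply: connect0.
  case/andP=> /andP[wz /eqP wzE] zp yE.
  have zh : phi z = Some h by rewrite -wzE.
  apply: connect_trans (IHp z zh zp yE).
  case: (rA _ _ _ _ wz wh zh) => [->|rwz]; first exact: connect0.
  by apply: connect1; rewrite /fibre_rel rwz (rphi _ _ wh) (rphi _ _ zh) eqxx.
- move=> h k hk; have [x [y [xh yk xy]]] := phiA h k hk.
  exists (r x), (r y); rewrite (rphi _ _ xh) (rphi _ _ yk); split=> //.
  case: (rA _ _ _ _ xy xh yk) => // rxy.
  have := rphi _ _ xh; rewrite rxy (rphi _ _ yk) => -[hkE].
  by move: (adj_neq hk); rewrite hkE eqxx.
Qed.

(** Contracting the edge from [v] to [a] turns the path [a], [v], [b] into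
    the edge [a], [b]. *)
Lemma del_add_edge_minor (H : sgraph) (a b : del_vertex) :
  adj v (val a) -> adj v (val b) -> minor H (add_edge a b) -> minor H G.
Proof.
move=> va vb /minorP[phi phiP]; apply/minorP.
pose psi (x : G) : option (add_edge a b) := Some (insubd a x).
have ida (x : del_vertex) : insubd a (val x) = x by apply: valKd.
have vE : insubd a v = a by apply: val_inj; rewrite val_insubd eqxx.
suff psiP : model psi by eexists; apply: model_trans phiP psiP.
have sub h x : insubd a x = h -> x = val h \/ x = v /\ h = a.
  case: (eqVneq x v) => [->|xv <-]; first by rewrite vE => <-; right.
  by left; rewrite val_insubd xv.
split.
- by move=> h; exists (val h); rewrite /psi ida.
- move=> h x y [/sub xh] [/sub yh].
  by case: xh yh => [->|[-> ->]] [->|[-> hE]]; rewrite ?connect0 ?hE //;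
    apply: connect1; rewrite /fibre_rel /psi vE ida eqxx ?va // adj_sym va.
- move=> h k /orP[hk|/andP[hk /eqP hkE]].
    by exists (val h), (val k); rewrite /psi !ida.
  have: h \in [set a; b] by rewrite -hkE !inE eqxx.
  have: k \in [set a; b] by rewrite -hkE !inE eqxx orbT.
  rewrite !inE => /orP[] /eqP kE /orP[] /eqP hE; subst h k.
  + by rewrite eqxx in hk.
  + by exists (val b), v; rewrite /psi ida vE adj_sym.
  + by exists v, (val b); rewrite /psi ida vE.
  + by rewrite eqxx in hk.
Qed.
End DelVertex.

(** * Longest paths and complete minors *)

Definition spath (G : sgraph) (s : seq G) := uniq s && sorted (@adj G) s.

Definition longest (G : sgraph) (s : seq G) :=
  spath s /\ forall t : seq G, spath t -> size t <= size s.

Lemma longest_exists (G : sgraph) : 0 < #|G| -> exists2 s : seq G, longest s & 0 < size s.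
Proof.
case/card_gt0P=> x _; pose P n := boolp.asbool (exists2 s : seq G, spath s & size s = n).
have P1 : P 1 by apply/boolp.asboolP; exists [:: x].
have Pb n : P n -> n <= #|G|.
  by case/boolp.asboolP=> s /andP[us _] <-; rewrite -(card_uniqP us) max_card.
case: (ex_maxnP (ex_intro _ 1 P1) Pb) => n /boolp.asboolP[s sp <-] smax.
exists s; last exact: smax.
by split=> // t tp; apply: smax; apply/boolp.asboolP; exists t.
Qed.

(** Otherwise the path could be prolonged. *)
Lemma longest_end (G : sgraph) (s : seq G) (x0 y : G) :
  longest s -> 0 < size s -> adj (nth x0 s 0) y -> y \in s.
Proof.
case=> /andP[us ss] smax s0 xy; apply/negPn/negP => ys.
have /smax : spath (y :: s); last by rewrite /= ltnn.
by move: xy s0 ys us ss {smax}; case: s => //= x p; rewrite adj_sym /spath /= => -> _ -> -> ->.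
Qed.

Lemma avoid_neighbour (G : sgraph) (x : G) (A : seq G) :
  size A < deg x -> exists2 y, adj x y & y \notin A.
Proof.
move=> dA; apply: boolp.contrapT => noy; move: dA; rewrite ltnNge => /negP; apply.
apply: leq_trans (card_size A); apply/subset_leq_card/subsetP => y; rewrite inE => xy.
by apply/negPn/negP => yA; apply: noy; exists y.
Qed.

(** A nondecreasing colouring of the positions cuts the path into consecutive
    segments, which are connected. *)
Lemma segments_minor (G : sgraph) (x0 : G) (s : seq G) r (c : nat -> 'I_r) :
  spath s -> {homo c : i j / i <= j} ->
  (forall k, exists2 i, i < size s & c i = k) ->
  (forall k l : 'I_r, k < l -> exists i j, [/\ i < size s, j < size s, c i = k,
     c j = l & adj (nth x0 s i) (nth x0 s j)]) ->
  minor (complete_graph r) G.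
Proof.
case/andP=> us ss c_homo cS cA; apply/minorP.
exists (fun x => if x \in s then Some (c (index x s)) else None).
have nthE i : i < size s ->
    (if nth x0 s i \in s then Some (c (index (nth x0 s i) s)) else None) = Some (c i).
  by move=> lt_i; rewrite mem_nth // index_uniq.
set phi := (X in model X).
have conn i j : i <= j -> j < size s -> c i = c j ->
    connect (fibre_rel phi) (nth x0 s i) (nth x0 s j).
  move=> ij js cij; rewrite -(subnKC ij) in js cij *.
  elim: (j - i) js cij => [|d IHd] js cij; first by rewrite addn0 connect0.
  rewrite addnS in js cij *.
  have le1 := c_homo i (i + d) (leq_addr _ _).
  have le2 := c_homo (i + d) (i + d).+1 (leqnSn _).
  have cid : c i = c (i + d) by apply/val_inj/eqP; rewrite eqn_leq le1 cij.
  apply: connect_trans (IHd (ltnW js) cid) (connect1 _).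
  rewrite /fibre_rel /phi !nthE ?(ltnW js) // -cid -cij eqxx andbT.
  exact: (sortedP x0 ss).
split.
- by move=> k; have [i is_ ik] := cS k; exists (nth x0 s i); rewrite /phi nthE ?ik.
- move=> k x y; rewrite {1 2}/phi; case: ifP => // xs [xk]; case: ifP => // ys [yk].
  rewrite -(nth_index x0 xs) -(nth_index x0 ys).
  have [ij|/ltnW ji] := leqP (index x s) (index y s).
    by apply: conn; rewrite ?index_mem ?xk ?yk.
  rewrite (sym_connect_sym _); first by apply: conn; rewrite ?index_mem ?xk ?yk.
  by move=> u v; rewrite /fibre_rel adj_sym eq_sym.
- move=> k l kl; wlog lt_kl : k l {kl} / k < l => [wl|].
    case: (ltngtP k l) => [||/val_inj kE]; first exact: wl.
      by move=> /wl[x [y [xl yk xy]]]; exists y, x; rewrite adj_sym.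
    by rewrite kE /adj /= /complete_rel eqxx in kl.
  have [i [j [is_ js ik jl ij]]] := cA k l lt_kl.
  by exists (nth x0 s i), (nth x0 s j); rewrite /phi !nthE // ik jl.
Qed.

(** Reversing the part of the path before [s_i] moves the end of the path to
    the vertex preceding [s_i] and leaves the remaining part in place. *)
Lemma rotation (G : sgraph) (x0 : G) (s : seq G) i :
  spath s -> 0 < i < size s -> adj (nth x0 s 0) (nth x0 s i) ->
  exists t : seq G, [/\ spath t, t =i s, size t = size s
    & forall k, k < size s -> nth x0 t k = nth x0 s (if k < i then i.-1 - k else k)].
Proof.
case/andP=> us ss /andP[i0 i_s] adj0i; pose t := rev (take i s) ++ drop i s.
have szt : size (take i s) = i by rewrite size_takel // ltnW.
have tE k : k < size s -> nth x0 t k = nth x0 s (if k < i then i.-1 - k else k).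
  move=> ks; rewrite nth_cat size_rev szt; case: ltnP => ki.
    rewrite nth_rev szt // nth_take; last by lia.
    by congr nth; lia.
  by rewrite nth_drop subnKC.
have pt : perm_eq t s by rewrite -[X in perm_eq _ X](cat_take_drop i s) perm_cat2r perm_rev.
exists t; split=> //; [| exact: perm_mem | exact: perm_size].
rewrite /spath (perm_uniq pt) us /=; apply/(sortedP x0) => k; rewrite (perm_size pt) => ks.
rewrite !tE ?(ltnW ks) //.
case: (ltngtP k.+1 i) => ki.
- rewrite adj_sym (_ : i.-1 - k = (i.-1 - k.+1).+1); last by lia.
  by apply: (sortedP x0 ss); lia.
- exact: (sortedP x0 ss).
- by move: adj0i; rewrite -ki ?ltnSn ?ltnn ?subnn /=.
Qed.

Lemma inord_leq r a b : b <= r -> a <= b -> (inord a : 'I_r.+1) <= (inord b : 'I_r.+1).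
Proof. by move=> br ab; rewrite !inordK ?ltnS // (leq_trans ab br). Qed.

(** Consecutive segments are adjacent along the path, so only the pair of outer
    segments needs a chord. *)
Lemma three_segments (G : sgraph) (x0 : G) (s : seq G) a b i j :
  spath s -> 0 < a -> a < b -> b < size s ->
  i < a -> b <= j < size s -> adj (nth x0 s i) (nth x0 s j) ->
  minor (complete_graph 3) G.
Proof.
move=> sp a0 ab bs ia /andP[bj js] ij.
pose c k : 'I_3 := inord (if k < a then 0 else if k < b then 1 else 2).
have c0 k : k < a -> c k = inord 0 by rewrite /c => ->.
have c1 k : a <= k < b -> c k = inord 1 by case/andP=> ak kb; rewrite /c ltnNge ak kb.
have c2 k : b <= k -> c k = inord 2.
  by move=> bk; rewrite /c !ltnNge bk (leq_trans (ltnW ab) bk).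
have ordE (k : 'I_3) d : val k = d -> k = inord d by move=> <-; rewrite inord_val.
have sA k : 0 < k < size s -> adj (nth x0 s k.-1) (nth x0 s k).
  case: k => // k /andP[_ ks]; case/andP: sp => _ ss; exact: (sortedP x0 ss).
apply: (@segments_minor G x0 s 3 c sp).
- move=> u v uv; apply: inord_leq; first by do 2?case: ifP.
  by case: (ltnP u a); case: (ltnP u b); case: (ltnP v a); case: (ltnP v b) => //; lia.
- case=> -[|[|[|//]]] lt3; rewrite (ordE (Ordinal lt3) _ erefl).
  + by exists 0; [lia | apply: c0].
  + by exists a; [lia | apply: c1; rewrite leqnn].
  + by exists b => //; apply: c2.
move=> k l; case: k => -[|[|[|//]]] k3; case: l => -[|[|[|//]]] l3 //= _;
  rewrite (ordE (Ordinal k3) _ erefl) (ordE (Ordinal l3) _ erefl) /=.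
- by exists a.-1, a; rewrite c0 ?c1 ?sA; try lia; split=> //; lia.
- by exists i, j; rewrite c0 // c2 //; split=> //; lia.
- by exists b.-1, b; rewrite c1 ?c2 ?sA; try lia; split=> //; lia.
Qed.

Lemma four_segments (G : sgraph) (x0 : G) (s : seq G) a b q i1 j1 i2 j2 i3 j3 :
  spath s -> 0 < a -> a < b -> b < q -> q < size s ->
  i1 < a -> b <= j1 < q -> adj (nth x0 s i1) (nth x0 s j1) ->
  i2 < a -> q <= j2 < size s -> adj (nth x0 s i2) (nth x0 s j2) ->
  a <= i3 < b -> q <= j3 < size s -> adj (nth x0 s i3) (nth x0 s j3) ->
  minor (complete_graph 4) G.
Proof.
move=> sp a0 ab bq qs i1a /andP[bj1 jq1] ij1 i2a /andP[qj2 js2] ij2 i3ab /andP[qj3 js3] ij3.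
pose c k : 'I_4 :=
  inord (if k < a then 0 else if k < b then 1 else if k < q then 2 else 3).
have c0 k : k < a -> c k = inord 0 by rewrite /c => ->.
have c1 k : a <= k < b -> c k = inord 1 by case/andP=> ak kb; rewrite /c ltnNge ak kb.
have c2 k : b <= k < q -> c k = inord 2.
  by case/andP=> bk kq; rewrite /c kq !ltnNge bk (leq_trans (ltnW ab) bk).
have c3 k : q <= k -> c k = inord 3.
  move=> qk; have bk := leq_trans (ltnW bq) qk.
  by rewrite /c !ltnNge qk bk (leq_trans (ltnW ab) bk).
have ordE (k : 'I_4) d : val k = d -> k = inord d by move=> <-; rewrite inord_val.
have sA k : 0 < k < size s -> adj (nth x0 s k.-1) (nth x0 s k).
  case: k => // k /andP[_ ks]; case/andP: sp => _ ss; exact: (sortedP x0 ss).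
apply: (@segments_minor G x0 s 4 c sp).
- move=> u v uv; apply: inord_leq; first by do 3?case: ifP.
  by case: (ltnP u a); case: (ltnP u b); case: (ltnP u q);
     case: (ltnP v a); case: (ltnP v b); case: (ltnP v q) => //; lia.
- case=> -[|[|[|[|//]]]] lt4; rewrite (ordE (Ordinal lt4) _ erefl).
  + by exists 0; [lia | apply: c0].
  + by exists a; [lia | apply: c1; rewrite leqnn].
  + by exists b; [lia | apply: c2; rewrite leqnn].
  + by exists q => //; apply: c3.
move=> k l; case: k => -[|[|[|[|//]]]] k4; case: l => -[|[|[|[|//]]]] l4 //= _;
  rewrite (ordE (Ordinal k4) _ erefl) (ordE (Ordinal l4) _ erefl) /=.
- by exists a.-1, a; rewrite c0 ?c1 ?sA; try lia; split=> //; lia.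
- by exists i1, j1; rewrite c0 // c2 ?bj1 //; split=> //; lia.
- by exists i2, j2; rewrite c0 // c3 //; split=> //; lia.
- by exists b.-1, b; rewrite c1 ?c2 ?sA; try lia; split=> //; lia.
- by exists i3, j3; rewrite c1 // c3 //; split=> //; lia.
- by exists q.-1, q; rewrite c2 ?c3 ?sA; try lia; split=> //; lia.
Qed.

(** The case of least [i] is the interesting one: rotating the path at its
    chord from [s_0] to [s_i] makes [s_(i-1)] an end vertex, so a third neighbour
    [s_m] of it lies on the path as well.  If [m < i], then the rotated path
    has a shorter chord at its end.  Otherwise the chords from [s_0] and
    [s_(i-1)] cross, and the path cut before [i-1], [i] and [minn m j] gives
    the four branch sets. *)
Lemma K4_of_chord (G : sgraph) (x0 : G) : (forall x : G, 3 <= deg x) ->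
  forall i (s : seq G), longest s -> 1 < i < size s ->
  adj (nth x0 s 0) (nth x0 s i) -> minor (complete_graph 4) G.
Proof.
move=> d3 i; have [n] := ubnP i; elim: n i => // n IHn i lt_in s sl /andP[i1 i_s] a0i.
have [s0 s1 i1_s i2_s] : [/\ 0 < size s, 1 < size s, i.-1 < size s & i.-2 < size s].
  by split; lia.
have [sp _] := sl; have /andP[us ss] := sp.
have [y a0y] := @avoid_neighbour G (nth x0 s 0) [:: nth x0 s 1; nth x0 s i] (d3 _).
rewrite !inE negb_or => /andP[y1 yi].
have ys := longest_end sl s0 a0y.
move: a0y y1 yi; rewrite -(nth_index x0 ys).
have := ys; rewrite -index_mem; move: (index y s) => j js a0j {y ys}.
rewrite !nth_uniq // => j1 ji.
have j0 : j != 0 by apply: contraTneq a0j => ->; rewrite adj_irr.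
have [lt_ji|le_ij] := ltnP j i.
  by apply: (IHn j _ s sl _ a0j); lia.
have [t [tp ts szt tE]] := @rotation G x0 s i sp (introT andP (conj (ltnW i1) i_s)) a0i.
have tl : longest t by split=> // u up; rewrite szt; apply: sl.2.
have [z] := @avoid_neighbour G (nth x0 s i.-1) [:: nth x0 s i.-2; nth x0 s i] (d3 _).
rewrite !inE negb_or => az /andP[z1 zi].
have zs : z \in s.
  rewrite -ts; apply: (@longest_end G t x0) => //; first by rewrite szt.
  by rewrite tE // (ltnW i1) subn0.
move: az z1 zi; rewrite -(nth_index x0 zs).
have := zs; rewrite -index_mem; move: (index z s) => m ms aim {z zs}.
rewrite !nth_uniq // => m1 mi.
have m0 : m != i.-1 by apply: contraTneq aim => ->; rewrite adj_irr.
have [lt_mi|le_im] := ltnP m i.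
  apply: (IHn (i.-1 - m) _ t tl); rewrite ?szt; try lia.
  rewrite !tE; try lia; rewrite (ltnW i1) subn0 ifT; last by lia.
  by rewrite subKn //; lia.
apply: (@four_segments G x0 s i.-1 i (minn m j) 0 i 0 j i.-1 m) => //;
  by rewrite ?leq_min ?gtn_min ?geq_minl ?geq_minr ?ms ?js //; lia.
Qed.

(** Fails for [r = 5]: the octahedron is planar and 4-regular. *)
Lemma min_deg_minor r (G : sgraph) : 2 <= r <= 4 -> 0 < #|G| ->
  (forall x : G, r.-1 <= deg x) -> minor (complete_graph r) G.
Proof.
move=> r24 G0 dG; have [s sl s0] := longest_exists G0.
have [x0 _] := card_gt0P G0.
have [sp _] := sl; have /andP[us ss] := sp.
have nbr A : size A < r.-1 -> exists i,
    [/\ 0 < i < size s, adj (nth x0 s 0) (nth x0 s i) & nth x0 s i \notin A].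
  move=> sA; have [y a0y yA] := avoid_neighbour (leq_trans sA (dG (nth x0 s 0))).
  have ys := longest_end sl s0 a0y.
  exists (index y s); rewrite nth_index // index_mem ys; split=> //.
  rewrite andbT lt0n; apply: contraTneq a0y => y0.
  by rewrite -(nth_index x0 ys) y0 adj_irr.
have ordE k (a : 'I_k.+1) b : val a = b -> a = inord b by move=> <-; rewrite inord_val.
case: r r24 dG nbr => [|[|[|[|[|//]]]]] // _ dG nbr.
- have [i [/andP[i0 i_s] a0i _]] := nbr [::] isT.
  apply: (@segments_minor G x0 s 2 (fun k => inord (0 < k)) sp).
  + move=> a b ab; apply: inord_leq; lia.
  + by case=> -[|[|//]] lt2; [exists 0 | exists i] => //; rewrite ?i0 (ordE _ (Ordinal lt2) _ erefl).
  + move=> k l; case: k => -[|[|//]] k2; case: l => -[|[|//]] l2 //= _.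
    by exists 0, i; split=> //; rewrite ?i0 (ordE _ (Ordinal _) _ erefl).
- have [i [/andP[i0 i_s] a0i]] := nbr [:: nth x0 s 1] isT.
  rewrite inE nth_uniq ?(leq_ltn_trans i0 i_s) // => i1.
  by apply: (@three_segments G x0 s 1 i 0 i) => //; lia.
- have [i [/andP[i0 i_s] a0i]] := nbr [:: nth x0 s 1] isT.
  rewrite inE nth_uniq ?(leq_ltn_trans i0 i_s) // => i1.
  by apply: (K4_of_chord (x0 := x0) dG sl _ a0i); lia.
Qed.

(** * The pure classes *)

Lemma add_edge_adj (G : sgraph) (x y u v : G) :
  adj (u : add_edge x y) v = adj u v || (u != v) && ([set u; v] == [set x; y]).
Proof. by []. Qed.

Lemma set2_eq (T : finType) (x y u v : T) : u != v ->
  ([set u; v] == [set x; y]) = (u == x) && (v == y) || (u == y) && (v == x).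
Proof.
move=> uv; apply/eqP/orP => [E|[] /andP[/eqP-> /eqP->] //]; last by rewrite setUC.
have: u \in [set x; y] by rewrite -E !inE eqxx.
have: v \in [set x; y] by rewrite -E !inE eqxx orbT.
rewrite !inE => /orP[] /eqP vE /orP[] /eqP uE; subst u v; rewrite ?eqxx in uv *;
  by [| left | right].
Qed.

Lemma add_edge_far (G : sgraph) (x y u v : G) :
  u != x -> u != y -> adj (u : add_edge x y) v = adj u v.
Proof.
move=> ux uy; rewrite add_edge_adj; case: eqVneq => [->|uv]; first by rewrite orbF.
by rewrite set2_eq // (negbTE ux) (negbTE uy) orbF.
Qed.

Lemma add_edge_end (G : sgraph) (x y v : G) : x != y ->
  adj (x : add_edge x y) v = adj x v || (v == y).
Proof.
move=> xy; rewrite add_edge_adj; case: (eqVneq x v) => [<-|xv].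
  by rewrite (negbTE xy).
by rewrite set2_eq // eqxx (negbTE xy) orbF.
Qed.

Lemma del_vertex_sub (G : sgraph) (r : rel G) rs ri (v : G) :
  (forall x y, x != v -> y != v -> r x y -> adj x y) ->
  subgraph (@del_vertex (@SGraph G r rs ri) v) G.
Proof.
move=> sub; exists val; split; first exact: val_inj.
by move=> x y; apply: sub; [apply: (valP x) | apply: (valP y)].
Qed.

Lemma del_add_edge_sub (G : sgraph) (v : G) (x y : del_vertex v) :
  subgraph (@del_vertex (add_edge (val x) (val y)) v) (add_edge x y).
Proof.
exists id; split=> // a b; rewrite /= /del_rel /= /add_edge_rel.
case: (eqVneq a b) => [->|ab]; first by rewrite eqxx.
by rewrite !set2_eq // -!val_eqE => /orP[?|/andP[_ ?]]; apply/orP; [left | right].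
Qed.

Lemma deg_complete r (x : complete_graph r) : deg x = r.-1.
Proof.
rewrite /deg (_ : [set _ | _] = [set~ x]); last first.
  by apply/setP => y; rewrite !inE /= /complete_rel eq_sym.
by rewrite cardsC1 card_ord.
Qed.

(** After the addition of [va] the vertex [v] is simplicial, hence useless for
    [K_r]; and deleting [v] undoes the addition. *)
Lemma simplicial_add_edge r (G : sgraph) (v a : G) :
  edge_maximal (complete_graph r) G -> v != a -> ~~ adj v a ->
  (forall b c : G, adj v b || (b == a) -> adj v c || (c == a) -> b != c -> adj b c) ->
  (deg v).+1 < r.-1 -> False.
Proof.
move=> [KG Gmax] va nva clq dv; have KG' := Gmax _ _ va nva.
apply: KG; have /simplicial_minor : forall b c : add_edge v a,
    adj (v : add_edge v a) b -> adj (v : add_edge v a) c -> b != c -> adj b c.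
  move=> b c; rewrite !add_edge_end // => vb vc bc.
  by rewrite add_edge_adj clq.
move=> /(_ (complete_graph r)) sim; apply: minor_subgraph (sim _ KG') => [|h].
  apply: del_vertex_sub => x y xv yv; rewrite /add_edge_rel.
  case: (eqVneq x y) => [->|xy]; first by rewrite orbF.
  by rewrite set2_eq // (negbTE xv) (negbTE yv) andbF /= orbF.
rewrite deg_complete; apply: leq_ltn_trans dv.
rewrite /deg (_ : [set y | adj (v : add_edge v a) y] = a |: [set y | adj v y]); last first.
  by apply/setP => y; rewrite in_setU1 !in_set add_edge_end // orbC.
by rewrite cardsU1 inE nva.
Qed.

(** An edge added elsewhere does not change the neighbourhood of [v], so the
    minor it creates survives the deletion of [v]. *)
Lemma edge_maximal_del r (G : sgraph) (v : G) :
  edge_maximal (complete_graph r) G ->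
  (forall a b : G, adj v a -> adj v b -> a != b -> adj a b) ->
  deg v < r.-1 -> edge_maximal (complete_graph r) (del_vertex v).
Proof.
move=> [KG Gmax] clq dv; split.
  by move=> /(minor_subgraph (del_subgraph v)).
move=> x y xy nxy; have /Gmax/(_ nxy) KG' : val x != val y by [].
have vx : v != val x by rewrite eq_sym (valP x).
have vy : v != val y by rewrite eq_sym (valP y).
have vE u : adj (v : add_edge (val x) (val y)) u = adj v u by apply: add_edge_far.
have /simplicial_minor : forall b c : add_edge (val x) (val y),
    adj (v : add_edge (val x) (val y)) b ->
    adj (v : add_edge (val x) (val y)) c -> b != c -> adj b c.
  by move=> b c; rewrite !vE => vb vc bc; rewrite add_edge_adj clq.
move=> /(_ (complete_graph r)) sim; apply: minor_subgraph (sim _ KG') => [|h].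
  exact: del_add_edge_sub.
rewrite deg_complete; apply: leq_ltn_trans dv.
by apply/subset_leq_card/subsetP => u; rewrite !inE vE.
Qed.

(** After the addition of the edge [ab] the vertex [v] would be simplicial, hence
    useless for [K_r]: when [r <= 4] it has no neighbours besides [a] and [b].
    But without [v] the edge [ab] comes for free by contracting [va]. *)
Lemma edge_maximal_simplicial r (G : sgraph) (v : G) :
  edge_maximal (complete_graph r) G -> r <= 4 -> deg v < r.-1 ->
  forall a b : G, adj v a -> adj v b -> a != b -> adj a b.
Proof.
move=> [KG Gmax] r4 dv a b va vb ab; apply/negPn/negP => nab.
have NE : [set y | adj v y] = [set a; b].
  apply/esym/eqP; rewrite eqEcard cards2 ab; apply/andP; split.
    by apply/subsetP => z; rewrite !inE => /orP[] /eqP->.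
  by move: dv; rewrite -/(deg v); lia.
have N z : adj v z -> z = a \/ z = b.
  move=> vz; have : z \in [set y | adj v y] by rewrite inE.
  by rewrite NE !inE => /orP[] /eqP; [left | right].
have vE u : adj (v : add_edge a b) u = adj v u by apply: add_edge_far; apply: adj_neq.
have av : a != v by rewrite eq_sym adj_neq.
have bv : b != v by rewrite eq_sym adj_neq.
have ab' : adj (a : add_edge a b) b by rewrite add_edge_end // eqxx orbT.
have /simplicial_minor : forall x y : add_edge a b,
    adj (v : add_edge a b) x -> adj (v : add_edge a b) y -> x != y -> adj x y.
  move=> x y; rewrite !vE => /N[]-> /N[]->; rewrite ?eqxx // => _.
  by rewrite adj_sym.
move=> /(_ (complete_graph r)) sim; apply: KG.
apply: (@del_add_edge_minor _ v _ (Sub a av) (Sub b bv)) => //.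
apply: minor_subgraph (sim _ (Gmax _ _ ab nab)) => [|h].
  exact: (@del_add_edge_sub _ v (Sub a av) (Sub b bv)).
rewrite deg_complete; apply: leq_ltn_trans dv.
by apply/subset_leq_card/subsetP => u; rewrite !inE vE.
Qed.

(** An edge at an isolated vertex could be added for free. *)
Lemma edge_maximal_no_isolated r (G : sgraph) (v : G) :
  edge_maximal (complete_graph r) G -> 2 < r -> 1 < #|G| -> 0 < deg v.
Proof.
move=> Gmax r2 G1; rewrite lt0n; apply/eqP => d0.
have N z : ~~ adj v z.
  have N0 := cards0_eq d0.
  by have := in_set0 z; rewrite -N0 inE => ->.
have [a av] : exists a : G, a != v.
  have /card_gt1P[a [b [_ _ ab]]] := G1.
  by case: (eqVneq a v) => [av|av]; [exists b; rewrite -av eq_sym | exists a].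
rewrite eq_sym in av.
apply: (simplicial_add_edge Gmax av (N a)); last by rewrite d0; lia.
by move=> b c; rewrite !(negbTE (N _)) /= => /eqP-> /eqP->; rewrite eqxx.
Qed.

(** The case left by the previous lemma is a vertex [v] of degree 1 with [r = 4].
    Its neighbour [a] has another neighbour [b], because [a] is not isolated in
    the edge-maximal graph without [v]; joining [v] to [b] is harmless, as its
    neighbours [a] and [b] are adjacent. *)
Lemma edge_maximal_deg r (G : sgraph) (v : G) :
  edge_maximal (complete_graph r) G -> 2 <= r <= 4 -> deg v < r.-1 ->
  deg v = minn r.-2 #|G|.-1.
Proof.
move=> Gmax /andP[r2 r4] dv; have clq := edge_maximal_simplicial Gmax r4 dv.
apply/eqP; rewrite eqn_leq leq_min; apply/andP; split.
  by have := deg_lt v; lia.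
rewrite leqNgt leq_min; apply/negP => /andP[d1 d2].
have G1 : 1 < #|G| by lia.
have r3 : 2 < r by lia.
have d0 := edge_maximal_no_isolated v Gmax r3 G1.
have {}dE : deg v = 1 by lia.
have /eqP/cards1P[a NE] := dE.
have N z : adj v z = (z == a) by rewrite -in_set1 -NE inE.
have va : adj v a by rewrite N.
have av : a != v by rewrite eq_sym adj_neq.
have Dmax := edge_maximal_del Gmax clq dv.
have := @edge_maximal_no_isolated r (del_vertex v) (Sub a av) Dmax r3.
rewrite card_del => /(_ ltac:(lia)) /card_gt0P[[b bv]]; rewrite inE /= /del_rel /= => ab.
have vb : v != b by rewrite eq_sym.
have nvb : ~~ adj v b by rewrite N eq_sym adj_neq.
apply: (simplicial_add_edge Gmax vb nvb); last by lia.
move=> x y; rewrite !N => /orP[] /eqP-> /orP[] /eqP->; rewrite ?eqxx // => _.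
by rewrite adj_sym.
Qed.

Lemma edge_maximal_complete_arcs r (G : sgraph) : 2 <= r <= 4 ->
  edge_maximal (complete_graph r) G ->
  arcs G = (\sum_(i < #|G|) minn r.-2 i).*2.
Proof.
move=> r24; have [n] := ubnP #|G|; elim: n G => // n IHn G leGn Gmax.
case: (posnP #|G|) => [G0|G0].
  rewrite G0 big_ord0 /arcs big1 // => x _.
  by have := card0_eq G0 x.
have [v dv] : exists v : G, deg v < r.-1.
  apply: boolp.contrapT => nov; case: (Gmax) => KG _; apply: KG.
  apply: min_deg_minor => // x; rewrite leqNgt; apply/negP => dx.
  by apply: nov; exists x.
have r4 : r <= 4 by case/andP: r24.
have Dmax := edge_maximal_del Gmax (edge_maximal_simplicial Gmax r4 dv) dv.
rewrite -(arcs_del v) IHn //; last by rewrite card_del; lia.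
rewrite card_del -doubleD (edge_maximal_deg Gmax) //; congr _.*2.
by case: #|G| G0 => // k _; rewrite big_ord_recr.
Qed.

Lemma pure_complete r : 2 <= r <= 4 -> pure_Ex (complete_graph r).
Proof.
move=> r24; apply/pureP => G1 G2 _ cE G1max G2max; apply: double_inj.
by rewrite -!arcs_edges !(edge_maximal_complete_arcs r24) // cE.
Qed.

Lemma path3_minor (G : sgraph) : minor (path_graph 3) G <->
  exists x y z : G, [/\ adj x y, adj y z & x != z].
Proof.
split=> [/minorP[phi [_ phiC phiA]]|[x [y [z [xy yz xz]]]]].
  pose o k : path_graph 3 := inord k.
  have [|u [v [u0 v1 uv]]] := phiA (o 0) (o 1); first by rewrite /= /path_rel !inordK.
  have [|w [z [w1 z2 wz]]] := phiA (o 1) (o 2); first by rewrite /= /path_rel !inordK.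
  have oE i j : i < 3 -> j < 3 -> o i = o j -> i = j.
    by move=> i3 j3 /(congr1 val); rewrite /= !inordK.
  case: (eqVneq v w) => [vw|vw].
    exists u, v, z; split=> //; first by rewrite vw.
    by apply/eqP => uz; move: u0; rewrite uz z2 => -[/oE-/(_ isT isT)].
  have [t vt t1] := fibre_step vw (phiC _ _ _ v1 w1).
  exists u, v, t; split=> //.
  by apply/eqP => ut; move: u0; rewrite ut t1 v1 => -[/oE-/(_ isT isT)].
apply: subgraph_minor; pose f (i : path_graph 3) := nth x [:: x; y; z] i.
have x_y := adj_neq xy; have y_z := adj_neq yz.
exists f; split.
  move=> i j /eqP; rewrite nth_uniq ?(ltn_ord i) ?(ltn_ord j) //.
    by move/eqP/val_inj.
  by rewrite /= !inE negb_or x_y xz y_z.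
rewrite /f; case=> -[|[|[|//]]] i3 [] -[|[|[|//]]] j3 //= _; by rewrite // adj_sym.
Qed.

(** All degrees are at most 1, and two isolated vertices could be joined. *)
Lemma pure_path3 : pure_Ex (path_graph 3).
Proof.
suff arcsE (G : sgraph) : edge_maximal (path_graph 3) G -> n_edges G = #|G|./2.
  by apply/pureP => G1 G2 _ cE /arcsE-> /arcsE->; rewrite cE.
case=> PG Gmax.
have d1 (x : G) : deg x <= 1.
  rewrite leqNgt; apply/negP => /card_gt1P[a [b []]]; rewrite !inE => xa xb ab.
  by apply: PG; apply/path3_minor; exists a, x, b; rewrite adj_sym.
have iso1 : #|[set x : G | deg x == 0]| <= 1.
  rewrite leqNgt; apply/negP => /card_gt1P[x [y []]]; rewrite !inE => x0 y0 xy.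
  have N (z t : G) : deg z == 0 -> adj z t = false.
    by rewrite cards_eq0 => /eqP z0; have := in_set0 t; rewrite -z0 inE.
  have nxy : ~~ adj x y by rewrite N.
  have /path3_minor[a [b [c [ab bc ac]]]] := Gmax x y xy nxy.
  move: ab bc; rewrite adj_sym.
  case: (eqVneq b x) => [->|bx].
    by rewrite !add_edge_end // !N //= => /eqP aE /eqP cE; rewrite aE cE eqxx in ac.
  case: (eqVneq b y) => [->|by_].
    rewrite ![adj (y : add_edge x y) _]adj_sym !add_edge_adj.
    rewrite ![adj _ y]adj_sym !N //= => /andP[ay ya] /andP[cy yc].
    rewrite !set2_eq // !eqxx (eq_sym y) (negbTE xy) !andbT !andbF !orbF in ya yc.
    by rewrite (eqP ya) (eqP yc) eqxx in ac.
  rewrite !add_edge_far // => ba bc; apply: PG; apply/path3_minor.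
  by exists a, b, c; rewrite adj_sym.
have : arcs G + #|[set x : G | deg x == 0]| = #|G|.
  rewrite /arcs -[#|[set x | _]|]sum1_card [X in _ + X]big_mkcond -big_split /= -sum1_card.
  by apply: eq_bigr => x _; rewrite inE; have := d1 x; case: (deg x) => [|[|]].
rewrite arcs_edges; lia.
Qed.

(** * Cliques of order [|H| - 1] *)

(** Let the branch set [{x, y}] represent [h0].  As it sees at least [deg h0]
    vertices of the clique, these can stand for the neighbours of [h0], and the
    other vertices of [H] go anywhere in the rest of the clique. *)
Lemma clique_minor (H G : sgraph) (h0 : H) (K : {set G}) (x y : G) :
  #|K| = #|H|.-1 -> {in K &, forall a b, a != b -> adj a b} ->
  x \notin K -> y \notin K -> (x == y) || adj x y ->
  deg h0 <= #|[set z in K | adj x z || adj y z]| -> minor H G.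
Proof.
move=> cardK clqK xK yK xy dN; set N := [set z in K | _] in dN.
have NK : N \subset K by apply/subsetP => z; rewrite inE => /andP[].
pose A := [set h | adj h0 h].
pose B := [set~ h0] :\: A.
have h0A : h0 \notin A by rewrite inE adj_irr.
pose sH := h0 :: enum A ++ enum B.
pose sG := x :: enum N ++ enum (K :\: N).
have sHu : uniq sH.
  rewrite /= cat_uniq !enum_uniq mem_cat !mem_enum !inE adj_irr eqxx /= andbT.
  by apply/hasPn => h; rewrite /= !mem_enum !inE => /andP[].
have sGu : uniq sG.
  rewrite /= cat_uniq !enum_uniq mem_cat !mem_enum negb_or /= andbT.
  rewrite (contra (subsetP NK x) xK) inE negb_and negbK xK orbT /=.
  by apply/hasPn => z; rewrite /= !mem_enum inE => /andP[].
have sHm h : h \in sH.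
  by rewrite inE mem_cat !mem_enum !inE; case: eqP => //= _; case: adj.
have szE : size sH = size sG.
  have cH : size sH = #|H|.
    by rewrite -(card_uniqP sHu); apply: eq_card => h; rewrite sHm.
  rewrite cH /= size_cat -!cardE cardsD (setIidPr NK) subnKC ?subset_leq_card //.
  by rewrite cardK prednK //; apply/card_gt0P; exists h0.
pose pos h := nth x sG (index h sH).
have pos_lt h : index h sH < size sG by rewrite -szE index_mem.
have posK h : nth h0 sH (index (pos h) sG) = h by rewrite index_uniq // nth_index.
have sG_K z : z \in enum N ++ enum (K :\: N) = (z \in K).
  rewrite mem_cat !mem_enum in_setD.
  by case: (boolP (z \in N)) => //= /(subsetP NK)->.
have pos_in h : h != h0 -> pos h \in K.
  move=> hh0; rewrite /pos /= eq_sym (negbTE hh0) /= -sG_K mem_nth //.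
  by have := pos_lt h; rewrite /= eq_sym (negbTE hh0).
have pos_N h : adj h0 h -> pos h \in N.
  move=> hh0; have h_h0 : h0 == h = false by apply/negbTE/adj_neq.
  have hA : h \in enum A by rewrite mem_enum inE.
  rewrite /pos /= h_h0 /= index_cat hA nth_cat.
  have lt_h : index h (enum A) < size (enum N).
    by rewrite -cardE; apply: leq_trans dN; rewrite /deg -/A cardE index_mem.
  by rewrite lt_h -mem_enum mem_nth.
pose phi z := if (z == x) || (z == y) then Some h0
  else if z \in K then Some (nth h0 sH (index z sG)) else None.
have neqK z w : z \in K -> w \notin K -> (z == w) = false.
  by move=> zK; apply: contraNF => /eqP<-.
have phiK z : z \in K -> phi z = Some (nth h0 sH (index z sG)).
  by move=> zK; rewrite /phi !(neqK z) // zK.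
have phix : phi x = Some h0 by rewrite /phi eqxx.
have phiy : phi y = Some h0 by rewrite /phi eqxx orbT.
have phip h : h != h0 -> phi (pos h) = Some h by move=> /pos_in/phiK->; rewrite posK.
have phiI z : phi z = Some h0 -> z = x \/ z = y.
  rewrite /phi; case: eqP => [|_]; first by left.
  case: eqP => [|_]; first by right.
  case: ifP => // zK [] /eqP.
  have zs : index z sG < size sH by rewrite szE index_mem inE sG_K zK orbT.
  rewrite -[X in _ == X]/(nth h0 sH 0) nth_uniq //= (eq_sym x) (neqK z) //.
apply/minorP; exists phi; split.
- move=> h; case: (eqVneq h h0) => [->|hh0]; first by exists x.
  by exists (pos h); apply: phip.
- move=> h u v uh vh; case: (eqVneq h h0) => [hE|hh0].
    have cxy : connect (fibre_rel phi) x y.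
      case/orP: xy => [/eqP->|xy]; first exact: connect0.
      by apply: connect1; rewrite /fibre_rel xy phix phiy eqxx.
    have cyx : connect (fibre_rel phi) y x.
      case/orP: xy => [/eqP->|xy]; first exact: connect0.
      by apply: connect1; rewrite /fibre_rel adj_sym xy phix phiy eqxx.
    by move: uh vh; rewrite hE => /phiI[]-> /phiI[]->; rewrite ?connect0.
  have inv w : phi w = Some h -> w = pos h.
    rewrite /phi; case: ifP => [_ [hE]|_]; first by rewrite hE eqxx in hh0.
    case: ifP => // wK [<-].
    have wG : w \in sG by rewrite inE sG_K wK orbT.
    have ws : index w sG < size sH by rewrite szE index_mem.
    by rewrite /pos (index_uniq _ ws sHu) nth_index.
  by rewrite (inv u uh) (inv v vh) connect0.
have pos0 k : adj h0 k -> exists u v, [/\ phi u = Some h0, phi v = Some k & adj u v].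
  move=> hk; have := pos_N k hk; rewrite inE => /andP[_ /orP[] a].
    by exists x, (pos k); rewrite phix phip // eq_sym adj_neq.
  by exists y, (pos k); rewrite phiy phip // eq_sym adj_neq.
move=> h k hk; case: (eqVneq h h0) => [hE|hh0]; first by rewrite hE in hk *; apply: pos0.
case: (eqVneq k h0) => [kE|kh0].
  have [|v [u [v0 uh vu]]] := pos0 h; first by rewrite adj_sym -kE.
  by exists u, v; rewrite kE adj_sym.
exists (pos h), (pos k); rewrite !phip //; split=> //; apply: clqK; rewrite ?pos_in //.
by apply: contra_neq (adj_neq hk) => E; rewrite -(posK h) E posK.
Qed.

Section Attach.
Variables (m : nat) (T : finType) (A : T -> {set 'I_m}).

Definition attach_rel : rel ('I_m + T) := fun u v =>
  match u, v with
  | inl i, inl j => i != j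
  | inl i, inr t | inr t, inl i => i \in A t
  | inr _, inr _ => false
  end.
Lemma attach_sym : symmetric attach_rel.
Proof. by case=> [i|s] [j|t] //=; rewrite eq_sym. Qed.
Lemma attach_irr : irreflexive attach_rel.
Proof. by case=> [i|s] //=; rewrite eqxx. Qed.
Definition attach := SGraph attach_sym attach_irr.

Lemma card_attach : #|attach| = m + #|T|.
Proof. by rewrite card_sum card_ord. Qed.

Lemma arcs_attach : arcs attach = m * m.-1 + (\sum_t #|A t|).*2.
Proof.
have sumA (B : {set 'I_m}) : \sum_(i < m) (i \in B) = #|B|.
  by rewrite -sum1_card [RHS]big_mkcond; apply: eq_bigr => i _; case: (i \in _).
rewrite /arcs (eq_bigr _ (fun x _ => degE x)) big_sumType /=.
rewrite (eq_bigr (fun i : 'I_m => m.-1 + \sum_t (i \in A t))); last first.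
  move=> i _; rewrite big_sumType /=; congr (_ + _).
  rewrite -(deg_complete (i : complete_graph m)) degE.
  by apply: eq_bigr => j _.
rewrite big_split /= sum_nat_const card_ord -addnA -addnn; congr (_ + (_ + _)).
  rewrite exchange_big /=; apply: eq_bigr => t _.
  exact: sumA.
apply: eq_bigr => t _; rewrite big_sumType /= [X in _ + X]big1 // addn0.
exact: sumA.
Qed.

Variable H : sgraph.
Hypothesis H_card : #|H| = m.+1.

(** A branch set without a vertex of the clique is a single attached vertex,
    whose degree is too small; but the clique has fewer than [|H|] vertices. *)
Lemma attach_free : (forall (h : H) t, #|A t| < deg h) -> ~ minor H attach.
Proof.
move=> dA /minorP[phi [phiS phiC phiA]].
have phi_l (h : H) : exists i, phi (inl i) = Some h.
  apply: boolp.contrapT => noi.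
  have [[i|t] th] := phiS h; first by case: noi; exists i.
  have only x : phi x = Some h -> x = inr t.
    move=> xh; apply/eqP/negPn/negP; rewrite eq_sym => tx.
    have [[j|s] ts sh] := fibre_step tx (phiC h _ _ th xh); last by [].
    by case: noi; exists j; rewrite sh.
  have := dA h t; rewrite ltnNge => /negP; apply.
  rewrite /deg -(card_imset [set y | adj h y] Some_inj).
  apply: leq_trans (leq_imset_card (fun i => phi (inl i)) _).
  apply/subset_leq_card/subsetP => o /imsetP[k]; rewrite inE => hk ->.
  have [x [y [/only-> yk ty]]] := phiA h k hk.
  by case: y yk ty => // i ik ti; rewrite -ik imset_f.
have : #|Some @: [set: H]| <= #|[set phi (inl i) | i in [set: 'I_m]]|.
  apply/subset_leq_card/subsetP => _ /imsetP[h _ ->].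
  by have [i <-] := phi_l h; rewrite imset_f.
rewrite (card_imset _ Some_inj) cardsT H_card => /leq_trans/(_ (leq_imset_card _ _)).
by rewrite cardsT card_ord ltnn.
Qed.

(** Adding an edge gives an attached vertex, or two of them to be contracted, at
    least [deg h0] neighbours in the clique. *)
Lemma attach_edge_maximal (h0 : H) : (forall h : H, deg h0 <= deg h) ->
  0 < deg h0 -> injective A -> (forall t, #|A t| = (deg h0).-1) ->
  edge_maximal H attach.
Proof.
move=> h0min d0 A_inj cA; split.
  by apply: attach_free => h t; rewrite cA prednK // h0min.
move=> x y xy nxy.
pose K : {set add_edge x y} := inl @: [set: 'I_m].
have cardK : #|K| = #|H|.-1.
  by rewrite card_imset ?cardsT ?card_ord ?H_card // => i j [].
have clqK : {in K &, forall a b, a != b -> adj a b}.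
  move=> _ _ /imsetP[i _ ->] /imsetP[j _ ->] ij.
  by rewrite add_edge_adj /= [i != j]ij.
have inlK i : (inl i : add_edge x y) \in K by apply: imset_f.
have inrK t : (inr t : add_edge x y) \notin K by apply/imsetP => -[].
have inl_inj : injective (inl : 'I_m -> add_edge x y) by move=> i j [].
have one i t : x = inl i /\ y = inr t \/ x = inr t /\ y = inl i -> i \notin A t ->
    minor H (add_edge x y).
  move=> xyE iA; apply: (@clique_minor _ _ h0 K (inr t) (inr t)); rewrite ?eqxx //.
  apply: (@leq_trans #|(inl : _ -> add_edge x y) @: (i |: A t)|).
    by rewrite (card_imset _ inl_inj) cardsU1 iA cA add1n prednK.
  apply/subset_leq_card/subsetP => _ /imsetP[j ji ->].
  rewrite inE inlK orbb add_edge_adj /=; case/setU1P: ji => [->|-> //].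
  by apply/orP; right; case: xyE => -[-> ->]; rewrite ?eqxx // setUC.
have two s t : x = inr s -> y = inr t -> minor H (add_edge x y).
  move=> xE yE; apply: (@clique_minor _ _ h0 K (inr s) (inr t)); rewrite ?inrK //.
    by rewrite add_edge_adj -xE -yE xy eqxx !orbT.
  have st : A s != A t by apply: contra_neq xy => /A_inj; rewrite xE yE => ->.
  apply: (@leq_trans #|(inl : _ -> add_edge x y) @: (A s :|: A t)|).
    rewrite (card_imset _ inl_inj) -[deg h0]prednK // -(cA s).
    apply/proper_card/properP; split; first exact: subsetUl.
    have /subsetPn[j jt js] : ~~ (A t \subset A s).
      by apply: contra st => ts; rewrite eq_sym eqEcard ts !cA /=.
    by exists j; rewrite // inE jt orbT.
  apply/subset_leq_card/subsetP => _ /imsetP[j ji ->].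
  rewrite inE inlK !add_edge_adj /=; case/setUP: ji => ->; rewrite ?orbT //.
case: x xy nxy @K cardK clqK inlK inrK inl_inj one two => [i|s];
  case: y => [j|t] xy nxy K cardK clqK inlK inrK inl_inj one two.
- by rewrite /= negbK in nxy; rewrite (eqP nxy) eqxx in xy.
- by apply: (one i t); [left | ].
- by apply: (one j s); [right | ].
- by apply: (two s t).
Qed.
End Attach.

Lemma leq_bin n k : 0 < k < n -> n <= 'C(n, k).
Proof.
elim: n k => [|n IHn] [|k] //= kn.
case: (posnP k) => [->|k0]; first by rewrite bin1.
rewrite binS; case: (eqVneq k.+1 n) => [kE|kn'].
  by rewrite -kE binn binSn add1n.
rewrite -addn1 leq_add ?IHn ?bin_gt0 //; lia.
Qed.

Lemma distinct_subsets m d k : 0 < d < m -> k <= m ->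
  exists A : 'I_k -> {set 'I_m}, injective A /\ forall t, #|A t| = d.
Proof.
move=> dm km; pose S := [set B : {set 'I_m} | #|B| == d].
have cS : k <= size (enum S).
  by rewrite -cardE card_draws card_ord (leq_trans km) // leq_bin.
exists (fun t => nth set0 (enum S) t); split.
  move=> s t /eqP; rewrite nth_uniq ?enum_uniq ?(leq_trans (ltn_ord _) cS) //.
  by move/eqP/val_inj.
move=> t; have := mem_nth set0 (leq_trans (ltn_ord t) cS).
by rewrite mem_enum inE => /eqP.
Qed.

(** * Two cliques sharing a small clique *)

Section TwoCliques.
Variables c a b : nat.

(** The join of [K_c] with the disjoint union of [K_a] and [K_b]. *)
Definition two_cliques_rel : rel ('I_c + ('I_a + 'I_b)) := fun u v =>
  match u, v with
  | inl i, inl j => i != j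
  | inl _, inr _ | inr _, inl _ => true
  | inr (inl i), inr (inl j) => i != j
  | inr (inr i), inr (inr j) => i != j
  | inr _, inr _ => false
  end.
Lemma two_cliques_sym : symmetric two_cliques_rel.
Proof. by case=> [i|[i|i]] [j|[j|j]] //=; rewrite eq_sym. Qed.
Lemma two_cliques_irr : irreflexive two_cliques_rel.
Proof. by case=> [i|[i|i]] //=; rewrite eqxx. Qed.
Definition two_cliques := SGraph two_cliques_sym two_cliques_irr.

Lemma card_two_cliques : #|two_cliques| = c + (a + b).
Proof. by rewrite !card_sum !card_ord. Qed.

Lemma arcs_two_cliques :
  arcs two_cliques = c * c.-1 + (c * (a + b)).*2 + a * a.-1 + b * b.-1.
Proof.
have sumK n (i : 'I_n) : \sum_(j < n) (i != j) = n.-1.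
  by rewrite -(deg_complete (i : complete_graph n)) degE; apply: eq_bigr.
have sum1n n : \sum_(j < n) true = n by rewrite sum_nat_const card_ord muln1.
have sum0n n : \sum_(j < n) false = 0 by rewrite big1.
rewrite /arcs (eq_bigr _ (fun x _ => degE x)) !big_sumType /=.
rewrite (eq_bigr (fun=> c.-1 + (a + b))); last first.
  by move=> i _; rewrite !big_sumType /= sumK !sum1n.
rewrite [X in _ + (X + _)](eq_bigr (fun=> c + a.-1)); last first.
  by move=> i _; rewrite !big_sumType /= sumK sum1n sum0n addn0.
rewrite [X in _ + (_ + X)](eq_bigr (fun=> c + b.-1)); last first.
  by move=> i _; rewrite !big_sumType /= sumK sum1n sum0n add0n.
rewrite !sum_nat_const !card_ord; lia.
Qed.

(** Some branch set lies in the first private part and some branch set in the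
    second one, as neither clique has [|H|] vertices.  The two corresponding
    vertices of [H] have at most [c] common neighbours, which contradicts the
    degrees or, for [c = 0], connectedness. *)
Lemma two_cliques_free (H : sgraph) : connected H ->
  c + a < #|H| -> c + b < #|H| ->
  (c = 0 \/ forall h : H, c + #|H| <= (deg h).*2.+1) ->
  ~ minor H two_cliques.
Proof.
move=> Hconn lt_a lt_b cP /minorP[phi [phiS phiC phiA]].
pose inZ h := exists i : 'I_c, phi (inl i) = Some h.
pose isl (x : two_cliques) := if x is inr (inl _) then true else false.
pose isr (x : two_cliques) := if x is inr (inr _) then true else false.
pose Z := [set h | boolp.asbool (inZ h)].
pose L := [set h | boolp.asbool (forall x, phi x = Some h -> isl x)].
pose R := [set h | boolp.asbool (forall x, phi x = Some h -> isr x)].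
have ZP h : reflect (inZ h) (h \in Z) by rewrite inE; apply: boolp.asboolP.
have LP h : reflect (forall x, phi x = Some h -> isl x) (h \in L).
  by rewrite inE; apply: boolp.asboolP.
have RP h : reflect (forall x, phi x = Some h -> isr x) (h \in R).
  by rewrite inE; apply: boolp.asboolP.
have conn h (P : pred two_cliques) x : h \notin Z -> phi x = Some h -> P x ->
    (forall u v, P u -> adj u v -> phi v = Some h -> P v) ->
    forall y, phi y = Some h -> P y.
  move=> hZ xh Px Pstep y yh; have /connectP[p] := phiC h x y xh yh.
  elim: p x xh Px => [|z p IHp] x xh Px /=; first by move=> _ ->.
  case/andP=> /andP[xz /eqP xzE] zp yE; have zh : phi z = Some h by rewrite -xzE.
  exact: IHp zh (Pstep _ _ Px xz zh) zp yE.
have cover h : [|| h \in Z, h \in L | h \in R].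
  case: (boolP (h \in Z)) => //= hZ; apply/orP.
  have noZ i : phi (inl i) = Some h -> False by move=> ih; case/ZP: hZ; exists i.
  have [[i|[i|i]] xh] := phiS h; first by case: (noZ i).
    left; apply/LP; apply: (conn h isl _ hZ xh) => // -[u|[u|u]] [v|[v|v]] //= _ _.
    by move/noZ.
  right; apply/RP; apply: (conn h isr _ hZ xh) => // -[u|[u|u]] [v|[v|v]] //= _ _.
  by move/noZ.
have disj h k : h \in L -> k \in R -> h != k.
  move=> /LP hL /RP hR; apply/eqP => hk.
  have [x xh] := phiS h; have := hL x xh; rewrite hk in xh; have := hR x xh.
  by case: x {xh} => [|[]].
have noLR h k : h \in L -> k \in R -> ~~ adj h k.
  move=> /LP hL /RP kR; apply/negP => /phiA[x [y [/hL xl /kR yr]]].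
  by case: x xl => [|[]] // i _; case: y yr => [|[]].
have cZ : #|Z| <= c.
  by rewrite -[X in _ <= X]card_ord; apply: (@card_cover H _ (fun i => phi (inl i)))
    => h /ZP.
have [l lL] : exists l, l \in L.
  apply: boolp.contrapT => noL; move: lt_b; rewrite ltnNge => /negP; apply.
  have -> : c + b = #|{: 'I_c + 'I_b}| by rewrite card_sum !card_ord.
  rewrite -cardsT.
  pose f (x : 'I_c + 'I_b) := if x is inr i then phi (inr (inr i)) else
    if x is inl i then phi (inl i) else None.
  apply: (@card_cover H _ f) => h _; case/or3P: (cover h) => [/ZP[i ih]|hL|/RP hR].
  - by exists (inl i).
  - by case: noL; exists h.
  - have [[i|[i|i]] xh] := phiS h; have := hR _ xh => // _.
    by exists (inr i).
have [r rR] : exists r, r \in R.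
  apply: boolp.contrapT => noR; move: lt_a; rewrite ltnNge => /negP; apply.
  have -> : c + a = #|{: 'I_c + 'I_a}| by rewrite card_sum !card_ord.
  rewrite -cardsT.
  pose f (x : 'I_c + 'I_a) := if x is inr i then phi (inr (inl i)) else
    if x is inl i then phi (inl i) else None.
  apply: (@card_cover H _ f) => h _; case/or3P: (cover h) => [/ZP[i ih]|/LP hL|hR].
  - by exists (inl i).
  - have [[i|[i|i]] xh] := phiS h; have := hL _ xh => // _.
    by exists (inr i).
  - by case: noR; exists h.
case: cP => [c0|degH].
  have Z0 h : h \notin Z.
    by move: cZ; rewrite c0 leqn0 cards_eq0 => /eqP->; rewrite inE.
  have /connectP[p] := Hconn l r.
  elim: p l lL => [|z p IHp] l lL /=; first by move=> _ rl; move: (disj _ _ lL rR); rewrite rl eqxx.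
  case/andP=> lz; apply: IHp; have := cover z; rewrite (negbTE (Z0 z)) /=.
  by case/orP => // zR; have := noLR _ _ lL zR; rewrite lz.
have dl : (deg l).+1 <= #|Z :|: L|.
  apply: (@leq_trans #|l |: [set y | adj l y]|).
    by rewrite cardsU1 inE adj_irr.
  apply/subset_leq_card/subsetP => y /setU1P[->|]; first by rewrite inE lL orbT.
  rewrite inE => ly; rewrite inE; case/or3P: (cover y) => [->|->|yR] //.
    by rewrite orbT.
  by have := noLR _ _ lL yR; rewrite ly.
have dr : (deg r).+1 <= #|Z :|: R|.
  apply: (@leq_trans #|r |: [set y | adj r y]|).
    by rewrite cardsU1 inE adj_irr.
  apply/subset_leq_card/subsetP => y /setU1P[->|]; first by rewrite inE rR orbT.
  rewrite inE => ry; rewrite inE; case/or3P: (cover y) => [->|yL|->] //.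
    by have := noLR _ _ yL rR; rewrite adj_sym ry.
  by rewrite orbT.
have LR : #|(Z :|: L) :&: (Z :|: R)| <= c.
  apply: leq_trans cZ; apply/subset_leq_card/subsetP => h.
  rewrite !in_setI !in_setU => /andP[/orP[//|hL] /orP[//|hR]].
  by have := disj h h hL hR; rewrite eqxx.
have UH : #|(Z :|: L) :|: (Z :|: R)| <= #|H| by apply: max_card.
move: (degH l) (degH r) dl dr LR UH (cardsUI (Z :|: L) (Z :|: R)).
by move: #|_ :|: (_ :|: _)| #|_ :&: _| #|_ :|: _| #|_ :|: _| => u i p q; lia.
Qed.
End TwoCliques.

(** * Minimum degree at least two *)

Lemma min_degP (H : sgraph) : 0 < #|H| ->
  exists h0 : H, forall h : H, deg h0 <= deg h.
Proof.
case/card_gt0P=> h _; case: (arg_minnP (@deg H) (isT : xpredT h)) => h0 _ h0min.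
by exists h0 => k; apply: h0min.
Qed.

(** Both graphs consist of a clique of order [|H| - 1] and [k] more vertices.
    The attached vertices bring [k (d - 1)] edges, those of the second clique
    [k (k - 1) / 2 + k c], which is more because [h + c > 2 d]. *)
Lemma not_pure_deg2 (H : sgraph) (h0 : H) : connected H ->
  (forall h : H, deg h0 <= deg h) -> 1 < deg h0 -> (deg h0).+1 < #|H| ->
  ~ pure_Ex H.
Proof.
move=> Hconn h0min d2 dH pureH; set d := deg h0 in d2 dH h0min.
pose c := d.*2.+1 - #|H|; pose k := #|H|.-1 - c.
have k0 : 0 < k by rewrite /k /c; lia.
have [|A [A_inj cA]] := @distinct_subsets #|H|.-1 d.-1 k _ (leq_subr _ _).
  by lia.
have cH : #|H| = #|H|.-1.+1 by lia.
have Xmax : edge_maximal H (attach A).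
  by apply: (attach_edge_maximal cH h0min); rewrite // -/d ltnW.
have YH : ~ minor H (two_cliques c k k).
  apply: two_cliques_free => //; try (rewrite /k; lia).
  case: (posnP c) => [|c0]; [by left | right => h].
  have := h0min h; rewrite /c in c0 *; lia.
have := pure_arcs pureH _ _ Xmax YH.
rewrite card_attach card_two_cliques card_ord arcs_attach arcs_two_cliques.
rewrite (eq_bigr (fun=> d.-1)) // sum_nat_const card_ord.
have mE : #|H|.-1 = c + k by rewrite /k; lia.
have cd : d.*2.+1 <= #|H| + c by rewrite /c; lia.
move: mE cd k0 d2 dH; move: c k {YH Xmax A_inj cA A} => c k; move: #|H| {cH} => h.
move=> mE cd k0 d2 dh /(_ ltac:(lia)) /(_ ltac:(lia)).
have sq : (c + k) * (c + k).-1 = c * c.-1 + (c * k).*2 + k * k.-1.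
  have sqp n : n * n.-1 + n = n * n by case: n => //= n; rewrite addnC -mulnS.
  move: (sqp (c + k)) (sqp c) (sqp k).
  move: ((c + k) * _) (c * c.-1) (k * k.-1) => u v w.
  by rewrite -addnn mulnDr !mulnDl (mulnC k c); lia.
rewrite mE sq => le; have : k * (c.*2 + k.-1) <= k * d.-1.*2.
  by rewrite mulnDr -!doubleMr (mulnC k c); move: le; rewrite mulnDr -!addnn; lia.
by rewrite leq_pmul2l //; lia.
Qed.

(** * Minimum degree one *)

(** An edge between the cliques gives the larger one a pendant neighbour, enough
    for the leaf [h0]. *)
Lemma two_cliques_edge_maximal (H : sgraph) (h0 : H) m b : connected H ->
  #|H| = m.+1 -> deg h0 = 1 -> b <= m -> edge_maximal H (two_cliques 0 m b).
Proof.
move=> Hconn cH d1 bm; split; first by apply: two_cliques_free; rewrite ?cH //; left.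
move=> x y xy nxy.
pose K : {set add_edge x y} := [set inr (inl i) | i in [set: 'I_m]].
have inj : injective (fun i : 'I_m => inr (inl i) : add_edge x y) by move=> i j [].
have join i j : adj (inr (inr j) : add_edge x y) (inr (inl i)) -> minor H (add_edge x y).
  move=> ji; have jK : inr (inr j) \notin K by apply/imsetP => -[].
  apply: (@clique_minor _ _ h0 K (inr (inr j)) (inr (inr j))); rewrite ?eqxx //.
  - by rewrite card_imset // cardsT card_ord cH.
  - move=> _ _ /imsetP[u _ ->] /imsetP[v _ ->] uv.
    by rewrite add_edge_adj /= (_ : u != v) //; apply: contra_neq uv => ->.
  - rewrite d1 card_gt0; apply/set0Pn; exists (inr (inl i)).
    by rewrite in_set imset_f // ji.
case: x xy nxy @K inj join => [[]//|[i|j]]; case: y => [[]//|[u|v]] xy nxy K inj join.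
- by rewrite /= negbK in nxy; rewrite (eqP nxy) eqxx in xy.
- by apply: (join i v); rewrite add_edge_adj setUC eqxx orbT.
- by apply: (join u j); rewrite add_edge_adj eqxx orbT.
- by rewrite /= negbK in nxy; rewrite (eqP nxy) eqxx in xy.
Qed.

Section Star.
Variable n : nat.
Definition star_rel : rel (option 'I_n) := fun x y => isSome x != isSome y.
Lemma star_sym : symmetric star_rel.
Proof. by move=> x y; rewrite /star_rel eq_sym. Qed.
Lemma star_irr : irreflexive star_rel.
Proof. by move=> x; rewrite /star_rel eqxx. Qed.
Definition star := SGraph star_sym star_irr.

(** The branch set of the centre covers all edges. *)
Lemma star_minor (H : sgraph) : 0 < #|H| -> minor H star ->
  exists h0 : H, forall h k, adj h k -> h = h0 \/ k = h0.
Proof.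
case/card_gt0P=> h1 _ /minorP[phi [_ _ phiA]].
exists (odflt h1 (phi None)) => h k /phiA[u [v [uh vk]]].
by case: u uh => [i|] uh; case: v vk => [j|] vk //= _; rewrite ?uh ?vk; [right | left].
Qed.
End Star.

(** On as many vertices as [H], a minor is a spanning subgraph. *)
Lemma spanning_minor_universal (H G : sgraph) (h0 : H) : #|H| = #|G| ->
  (forall h, h != h0 -> adj h0 h) -> minor H G ->
  exists x0 : G, forall x, x != x0 -> adj x0 x.
Proof.
move=> cE univ /minorP[phi [phiS _ phiA]].
have phiSb h : exists x, phi x == Some h by have [x xh] := phiS h; exists x; apply/eqP.
pose s h := xchoose (phiSb h).
have sP h : phi (s h) = Some h by apply/eqP/(xchooseP (phiSb h)).
have s_inj : injective s by move=> h k hk; have := sP h; rewrite hk sP => -[].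
have [t _ tK] : bijective s by apply: inj_card_bij; rewrite ?cE.
have sE x h : phi x = Some h -> x = s h by rewrite -(tK x) sP => -[->].
exists (s h0) => x xs; rewrite -(tK x).
have /univ/phiA[u [v [/sE-> /sE->]]] // : t x != h0.
by apply: contra_neq xs => <-; rewrite tK.
Qed.

Section NoUniversal.
Variable n : nat.
(** The complement of the disjoint union of [K_2] and [K_(1,n)].  It has no
    universal vertex when [n > 0], and misses only [n + 1] edges on [n + 3]
    vertices. *)
Definition no_universal_rel : rel (bool + option 'I_n) := fun x y =>
  match x, y with
  | inl _, inr _ | inr _, inl _ => true
  | inr (Some i), inr (Some j) => i != j
  | _, _ => false
  end.
Lemma no_universal_sym : symmetric no_universal_rel.
Proof. by case=> [i|[i|]] [j|[j|]] //=; rewrite eq_sym. Qed.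
Lemma no_universal_irr : irreflexive no_universal_rel.
Proof. by case=> [i|[i|]] //=; rewrite eqxx. Qed.
Definition no_universal := SGraph no_universal_sym no_universal_irr.

Lemma card_no_universal : #|no_universal| = n + 3.
Proof. by rewrite card_sum card_option card_bool card_ord; lia. Qed.

Lemma arcs_no_universal : arcs no_universal = n * n.-1 + 4 * n.+1.
Proof.
have sumO (F : option 'I_n -> nat) : \sum_x F x = F None + \sum_(i < n) F (Some i).
  rewrite (bigD1 None) //=; congr (_ + _).
  by rewrite [LHS](reindex_omap (op := addn) Some id) //=; [apply: eq_bigl => i; rewrite eqxx | case].
have sumK (i : 'I_n) : \sum_(j < n) (i != j) = n.-1.
  by rewrite -(deg_complete (i : complete_graph n)) degE; apply: eq_bigr.
have sum1n : \sum_(j < n) true = n by rewrite sum_nat_const card_ord muln1.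
have sum0n : \sum_(j < n) false = 0 by rewrite big1.
rewrite /arcs (eq_bigr _ (fun x _ => degE x)) big_sumType /= big_bool /= sumO.
rewrite !big_sumType /= !big_bool /= !sumO /= sum1n sum0n.
rewrite (eq_bigr (fun=> 2 + n.-1)); last first.
  by move=> i _; rewrite big_sumType /= big_bool /= sumO sumK.
rewrite sum_nat_const card_ord; lia.
Qed.

Lemma no_universalP : 0 < n ->
  ~ exists x0 : no_universal, forall x, x != x0 -> adj x0 x.
Proof.
move=> n0 [[b|[i|]] univ].
- by have := univ (inl (~~ b)); case: b {univ} => /(_ isT).
- by have := univ (inr None) isT.
- by have := univ (inr (Some (Ordinal n0))) isT.
Qed.
End NoUniversal.

Lemma connect_exit (T : finType) (e : rel T) (K : {set T}) x y :
  connect e x y -> x \in K -> y \notin K ->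
  exists u v, [/\ u \in K, v \notin K & e u v].
Proof.
case/connectP=> p; elim: p x => [|z p IHp] x /=; first by move=> _ -> ->.
case/andP=> xz zp yE xK yK; case: (boolP (z \in K)) => zK; first exact: IHp zK yK.
by exists x, z.
Qed.

(** Disjoint cliques show that a connected edge-maximal graph [G] on
    [2 (|H| - 1)] vertices would have average degree [|H| - 2], that deleting a
    vertex costs at least [|H| - 2] edges, and that nothing can be added after
    the deletion.  So a vertex of small degree lies in a clique of order
    [|H| - 1], and an edge leaving that clique creates [H]. *)
Lemma leaf_extremal (H : sgraph) (h0 : H) (G : sgraph) m : connected H ->
  pure_Ex H -> deg h0 = 1 -> #|H| = m.+2 -> 0 < m -> edge_maximal H G ->
  connected G -> #|G| = m.+1.*2 -> False.
Proof.
move=> Hconn pureH d1 cH m0 Gmax Gconn cG; have [HG _] := Gmax.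
have G0 : 0 < #|G| by rewrite cG.
have Y1 := @two_cliques_edge_maximal H h0 m.+1 m.+1 Hconn cH d1 (leqnn _).
have Y2 := @two_cliques_edge_maximal H h0 m.+1 m Hconn cH d1 (leqnSn _).
have arcsG : arcs G = (m.+1 * m).*2.
  have /pureP uniqE := pureH.
  rewrite arcs_edges (uniqE G _ G0 _ Gmax Y1); last by rewrite card_two_cliques cG -addnn.
  by rewrite -arcs_edges arcs_two_cliques !mul0n /= double0 !add0n -addnn.
have bound (G' : sgraph) : ~ minor H G' -> #|G'| = m.*2.+1 -> arcs G' <= (m * m).*2.
  move=> HG' cG'; have := pure_arcs pureH _ _ Y2 HG'.
  rewrite card_two_cliques arcs_two_cliques cG' => /(_ ltac:(lia)) /(_ ltac:(lia)).
  move=> le; apply: leq_trans le _.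
  by move: m0; case: (m) => // n _; rewrite /= !mulSn !mulnS; lia.
have [y dy] : exists y : G, deg y <= m.
  apply: boolp.contrapT => noy.
  have : \sum_(x : G) m.+1 <= arcs G.
    by apply: leq_sum => x _; rewrite ltnNge; apply/negP => dx; apply: noy; exists x.
  by rewrite sum_nat_const cG arcsG -doubleMl leq_double leq_pmul2l // ltnn.
have cD : #|del_vertex y| = m.*2.+1 by rewrite card_del cG doubleS.
have HD : ~ minor H (del_vertex y) by move=> /(minor_subgraph (del_subgraph y)).
have arcsD := arcs_del y; have := bound _ HD cD => le.
have dyE : deg y = m by move: le arcsD; rewrite arcsG mulSn; lia.
have arcsDE : arcs (del_vertex y) = (m * m).*2.
  by move: arcsD; rewrite arcsG dyE mulSn; lia.
have clqN a b : adj y a -> adj y b -> a != b -> adj a b.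
  (* contracting an edge at [y] would make room for the edge [ab], although the
     graph without [y] already has as many edges as an [H]-free graph can *)
  move=> ya yb ab; apply/negPn/negP => nab.
  have ay : a != y by rewrite eq_sym adj_neq.
  have by_ : b != y by rewrite eq_sym adj_neq.
  pose u : del_vertex y := Sub a ay; pose v : del_vertex y := Sub b by_.
  have lt := @add_edge_arcs (del_vertex y) u v ab nab.
  have := bound (add_edge u v); rewrite cD leqNgt -arcsDE lt.
  by move=> h; case/negP: (h (fun mi => HG (@del_add_edge_minor _ y H u v ya yb mi)) erefl).
pose K := y |: [set x | adj y x].
have cK : #|K| = m.+1 by rewrite cardsU1 inE adj_irr -/(deg y) dyE.
have [t tK] : exists t, t \notin K.
  apply: boolp.contrapT => not; have : #|G| <= #|K|.
    by apply/subset_leq_card/subsetP => x _; apply/negPn/negP => xK; apply: not; exists x.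
  by rewrite cK cG; lia.
have [z [w [zK wK zw]]] := connect_exit (Gconn y t) (setU11 _ _) tK.
apply: HG; apply: (@clique_minor _ _ h0 K w w); rewrite ?eqxx ?cK ?cH //.
  have NK x : x \in K -> x = y \/ adj y x.
    by case/setU1P=> [->|]; [left | rewrite inE; right].
  move=> a b /NK[->|ya] /NK[->|yb] //; first by rewrite eqxx.
    by rewrite adj_sym.
  exact: clqN.
rewrite d1 card_gt0; apply/set0Pn; exists z.
by rewrite in_set zK adj_sym zw.
Qed.

(** The star on [2 (|H| - 1)] vertices extends to a graph excluded by the
    previous lemma, unless the edges of [H] have a common end [c], which is then
    universal by connectedness. *)
Lemma not_pure_leaf (H : sgraph) (h0 : H) : connected H -> deg h0 = 1 ->
  3 < #|H| -> ~ pure_Ex H.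
Proof.
move=> Hconn d1 H4 pureH; pose m := #|H|.-2.
have cH : #|H| = m.+2 by rewrite /m; lia.
have m2 : 1 < m by rewrite /m; lia.
case: (boolp.pselect (minor H (star m.*2.+1))) => [/star_minor|HS].
  case=> [|c cP]; first by lia.
  have univ h : h != c -> adj c h.
    move=> hc; have [u [v [/set1P-> _ hv]]] : exists u v,
        [/\ u \in [set h], v \notin [set h] & adj u v].
      by apply: connect_exit (Hconn h c) _ _; rewrite !inE // eq_sym.
    case: (cP h v hv) => [hE|<-]; first by rewrite hE eqxx in hc.
    by rewrite adj_sym.
  have Ymax := @two_cliques_edge_maximal H h0 m.+1 1 Hconn cH d1 isT.
  have J : ~ minor H (no_universal m.-1).
    move=> /(spanning_minor_universal _ univ); rewrite card_no_universal cH => J.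
    by apply: (@no_universalP m.-1); [lia | apply: J; lia].
  have := pure_arcs pureH _ _ Ymax J.
  rewrite card_two_cliques card_no_universal => /(_ ltac:(lia)) /(_ ltac:(lia)).
  rewrite arcs_two_cliques arcs_no_universal.
  by move: m2; case: (m) => [|[|n]] // _; rewrite /= !mulSn !mulnS; lia.
have [r [rs [ri [sub rmax]]]] := edge_maximal_ext HS.
apply: (leaf_extremal Hconn pureH d1 cH (ltnW m2) rmax).
  have c0 (x : option 'I_m.*2.+1) : connect r x None.
    by case: x => [i|]; [apply/connect1/sub | apply: connect0].
  move=> x y; apply: connect_trans (c0 x) _.
  by rewrite (sym_connect_sym rs); apply: c0.
by rewrite card_option card_ord doubleS.
Qed.

(** * Complete graphs on at least five vertices *)

(** The Wagner graph: the cycle of length 8 with its four long diagonals. *)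
Definition wagner (i j : nat) : bool := (j + 8 - i) %% 8 \in [:: 1; 4; 7].

(** A partition into five branch sets of a [K_5] model that uses the added edge
    [ij].  Up to a rotation and an exchange of the ends, [i = 0] and [j] is 2 or 3;
    the two ends are the singleton branch sets, and the other six vertices are
    matched into three pairs of neighbours. *)
Definition wagner_colour (i j z : nat) : nat :=
  let near := [:: 0; 2; 1; 3; 3; 2; 4; 4] in
  let far := [:: 0; 2; 2; 1; 3; 3; 4; 4] in
  match (j + 8 - i) %% 8 with
  | 2 => nth 0 near ((z + 8 - i) %% 8)
  | 3 => nth 0 far ((z + 8 - i) %% 8)
  | 5 => nth 0 far ((z + 8 - j) %% 8)
  | _ => nth 0 near ((z + 8 - j) %% 8)
  end.

Definition wagner_colour_ok (i j : nat) : bool :=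
  [&& all (fun z => wagner_colour i j z < 5) (iota 0 8),
      all (fun c => has (fun z => wagner_colour i j z == c) (iota 0 8)) (iota 0 5),
      all (fun u => all (fun v => (wagner_colour i j u == wagner_colour i j v) ==>
        ((u == v) || wagner u v)) (iota 0 8)) (iota 0 8)
    & all (fun c => all (fun d => (c == d) || has (fun u => has (fun v =>
        [&& wagner_colour i j u == c, wagner_colour i j v == d &
          [|| wagner u v, (u == i) && (v == j) | (u == j) && (v == i)]])
        (iota 0 8)) (iota 0 8)) (iota 0 5)) (iota 0 5)].

Lemma wagner_check : all (fun i => all (fun j =>
  [|| i == j, wagner i j | wagner_colour_ok i j]) (iota 0 8)) (iota 0 8).
Proof. by vm_compute. Qed.

Lemma mem_iota8 (i : 'I_8) : (i : nat) \in iota 0 8.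
Proof. by rewrite mem_iota /= ltn_ord. Qed.

Section WagnerJoin.
Variable s : nat.

Definition wagner_join_rel : rel ('I_8 + 'I_s) := fun x y =>
  match x, y with
  | inl i, inl j => wagner i j
  | inr i, inr j => i != j
  | _, _ => true
  end.
Lemma wagner_sym (i j : 'I_8) : wagner i j = wagner j i.
Proof.
have : all (fun i => all (fun j => wagner i j == wagner j i) (iota 0 8)) (iota 0 8) by [].
by move=> /allP/(_ i (mem_iota8 i))/allP/(_ j (mem_iota8 j))/eqP.
Qed.
Lemma wagner_join_sym : symmetric wagner_join_rel.
Proof. by case=> [i|i] [j|j] //=; rewrite ?(eq_sym i) // wagner_sym. Qed.
Lemma wagner_join_irr : irreflexive wagner_join_rel.
Proof.
case=> [i|i] /=; last by rewrite eqxx.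
have : all (fun i => ~~ wagner i i) (iota 0 8) by [].
by move=> /allP/(_ i (mem_iota8 i))/negbTE.
Qed.
Definition wagner_join := SGraph wagner_join_sym wagner_join_irr.

Lemma card_wagner_join : #|wagner_join| = 8 + s.
Proof. by rewrite card_sum !card_ord. Qed.

Lemma wagner_deg (i : 'I_8) : \sum_(j < 8) wagner i j = 3.
Proof.
have : all (fun i => sumn [seq nat_of_bool (wagner i j) | j <- iota 0 8] == 3) (iota 0 8) by [].
move=> /allP/(_ i (mem_iota8 i))/eqP e; rewrite -[RHS]e.
by rewrite sumnE big_map -[iota 0 8]/(index_iota 0 8) big_mkord.
Qed.

Lemma arcs_wagner_join : arcs wagner_join = 8 * (3 + s) + s * (8 + s.-1).
Proof.
rewrite /arcs (eq_bigr _ (fun x _ => degE x)) big_sumType /=.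
rewrite (eq_bigr (fun=> 3 + s)); last first.
  by move=> i _; rewrite big_sumType /= wagner_deg sum_nat_const card_ord muln1.
rewrite [X in _ + X](eq_bigr (fun=> 8 + s.-1)); last first.
  move=> i _; rewrite big_sumType /= sum_nat_const card_ord muln1; congr (_ + _).
  by rewrite -(deg_complete (i : complete_graph s)) degE; apply: eq_bigr.
by rewrite !sum_nat_const !card_ord.
Qed.

(** At least five branch sets avoid the [s] joined vertices.  In the Wagner graph
    every vertex has degree 3, so each of these branch sets needs two of the eight
    vertices to see the four others. *)
Lemma wagner_join_free : ~ minor (complete_graph (5 + s)) wagner_join.
Proof.
move=> /minorP[phi [phiS phiC phiA]].
pose Z := [set h | [exists i : 'I_s, phi (inr i) == Some h]].
have cZ : #|Z| <= s.
  rewrite -[X in _ <= X]card_ord.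
  apply: (@card_cover (complete_graph (5 + s)) _ (fun i : 'I_s => phi (inr i))) => h.
  by rewrite inE => /existsP[i /eqP ih]; exists i.
have cW : 5 <= #|~: Z|.
  by have := cardsC Z; rewrite card_ord; move: cZ; lia.
have inW h x : h \in ~: Z -> phi x = Some h -> exists2 i, x = inl i & phi (inl i) = Some h.
  rewrite !inE => hZ; case: x => [i|i] xh; first by exists i.
  by case/existsP: hZ; exists i; rewrite xh.
pose F h := [set i : 'I_8 | phi (inl i) == Some h].
have F2 h : h \in ~: Z -> 2 <= #|F h|.
  move=> hW; rewrite leqNgt; apply/negP; rewrite ltnS => F1.
  have [x /(inW _ _ hW)[i _ ih]] := phiS h.
  have Fi j : phi (inl j) = Some h -> j = i.
    by move=> jh; apply: (card_le1_eqP F1); rewrite inE ?ih ?jh.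
  have : #|(~: Z) :\ h| <= 3.
    have d3 : #|[set j : 'I_8 | wagner i j]| <= 3.
      rewrite -[X in _ <= X](wagner_deg i) -sum1_card big_mkcond leq_sum // => j _.
      by rewrite inE; case: wagner.
    apply: leq_trans d3; rewrite -(card_imset _ Some_inj).
    apply: leq_trans (leq_imset_card (fun j => phi (inl j)) _).
    apply/subset_leq_card/subsetP => o /imsetP[k]; rewrite 2!inE => /andP[kh kW] ->.
    have [|u [v [uh vk uv]]] := phiA h k; first by rewrite /= /complete_rel eq_sym.
    have [u' uE uh'] := inW _ _ hW uh; have [v' vE vk'] := inW _ _ kW vk.
    rewrite -vk'; apply: imset_f; rewrite inE.
    by move: uv; rewrite uE vE (Fi u' uh').
  by move: cW; rewrite (cardsD1 h) hW; lia.
have : \sum_(h in ~: Z) 2 <= 8.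
  apply: (@leq_trans (\sum_(h in ~: Z) #|F h|)); first by apply: leq_sum.
  apply: (@leq_trans (\sum_(h in ~: Z) \sum_(i < 8) (phi (inl i) == Some h))).
    apply: leq_sum => h _; rewrite -sum1_card big_mkcond leq_sum // => i _.
    by rewrite inE; case: eqP.
  rewrite exchange_big /=; apply: (@leq_trans (\sum_(i < 8) 1)); last first.
    by rewrite sum_nat_const card_ord.
  apply: leq_sum => i _; case: (phi (inl i)) => [h|]; last by rewrite big1.
  apply: (@leq_trans #|[set h]|); last by rewrite cards1.
  rewrite -sum1_card big_mkcond [X in _ <= X]big_mkcond leq_sum // => k _.
  by rewrite in_set1; case: ifP => // _; case: (eqVneq k h) => [->|kh];
    case: eqP => // -[hk]; rewrite hk eqxx in kh.
by rewrite sum_nat_const; move: cW; lia.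
Qed.

Lemma wagner_join_edge_maximal :
  edge_maximal (complete_graph (5 + s)) wagner_join.
Proof.
split; first exact: wagner_join_free.
move=> x y; case: x y => [i|i] [j|j] xy nxy //; last first.
  by rewrite /= negbK in nxy; rewrite (eqP nxy) eqxx in xy.
have ij : (i : nat) != j by apply: contra_neq xy => /val_inj->.
have := wagner_check => /allP/(_ i (mem_iota8 i))/allP/(_ j (mem_iota8 j)).
rewrite (negbTE ij) (negbTE (nxy : ~~ wagner i j)) /= => /and4P[].
pose col (z : 'I_8) := wagner_colour i j z.
move=> /allP c5 /allP cS /allP cC /allP cA.
have o8 z : z \in iota 0 8 -> {z' : 'I_8 | z' = z :> nat}.
  by rewrite mem_iota => z8; exists (Ordinal z8).
have o5 (c : 'I_5) : (c : nat) \in iota 0 5 by rewrite mem_iota /= ltn_ord.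
pose f (z : 'I_8) : 'I_5 := inord (col z).
have fE (z : 'I_8) : f z = col z :> nat by rewrite inordK // c5 ?mem_iota8.
apply/minorP; exists (fun x : add_edge (inl i : wagner_join) (inl j) =>
  Some (match x with inl z => lshift s (f z) | inr t => rshift 5 t end)).
set phi := (X in model X).
have fS c : exists z, f z = c.
  have /hasP[z /o8[z' <-] /eqP zc] := cS c (o5 c).
  by exists z'; apply: val_inj; rewrite /= fE.
split.
- move=> h; rewrite -(splitK h); case: (split h) => [c|t] /=; last by exists (inr t).
  by have [z zc] := fS c; exists (inl z); rewrite /phi zc.
- move=> h [u|u] [v|v] uh vh; have /Some_inj/eqP := etrans uh (esym vh);
    rewrite ?eq_lshift ?eq_rshift ?eq_lrshift ?eq_rlshift // => /eqP uv.
    have := cC u (mem_iota8 u) => /allP/(_ v (mem_iota8 v)).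
    rewrite -[wagner_colour _ _ u]/(col u) -[wagner_colour _ _ v]/(col v).
    rewrite -!fE uv eqxx /= => /orP[/eqP/val_inj->|w]; first exact: connect0.
    apply: connect1; rewrite /fibre_rel /phi uv eqxx andbT.
    by rewrite add_edge_adj /= w.
  by rewrite uv connect0.
- move=> h k; rewrite -(splitK h) -(splitK k).
  case: (split h) (split k) => [c|t] [d|t'] /= hk.
  + have cd : (c : nat) != d by apply: contra_neq hk => /val_inj->.
    have := cA c (o5 c) => /allP/(_ d (o5 d)); rewrite (negbTE cd) orFb.
    case/hasP=> u /o8[u' <-] /hasP[v /o8[v' <-] /and3P[/eqP uc /eqP vd e]].
    exists (inl u'), (inl v'); split.
    * by rewrite /phi; congr (Some (lshift _ _)); apply: val_inj; rewrite /= fE.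
    * by rewrite /phi; congr (Some (lshift _ _)); apply: val_inj; rewrite /= fE.
    rewrite /add_edge_rel /=; case/or3P: e => [->//|/andP[/eqP/val_inj-> /eqP/val_inj->]|].
      by rewrite xy eqxx orbT.
    by case/andP=> /eqP/val_inj-> /eqP/val_inj->; rewrite eq_sym xy setUC eqxx orbT.
  + by have [z zc] := fS c; exists (inl z), (inr t'); rewrite /phi zc.
  + by have [z zc] := fS d; exists (inr t), (inl z); rewrite /phi zc.
  + exists (inr t), (inr t'); split=> //; rewrite /add_edge_rel /=.
    by rewrite (_ : t != t') //; apply: contra_neq hk => ->.
Qed.
End WagnerJoin.

Lemma not_pure_complete s : ~ pure_Ex (complete_graph (5 + s)).
Proof.
move=> pureK; pose A (t : 'I_4) := [set~ ord0 : 'I_(4 + s)].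
have cA t : #|A t| = 3 + s by rewrite cardsC1 card_ord.
have Afree : ~ minor (complete_graph (5 + s)) (attach A).
  by apply: attach_free => [|h t]; rewrite ?card_ord // cA deg_complete.
have := pure_arcs pureK _ _ (wagner_join_edge_maximal s) Afree.
rewrite card_wagner_join card_attach !card_ord.
move=> /(_ ltac:(lia)) /(_ ltac:(lia)).
rewrite arcs_attach arcs_wagner_join (eq_bigr (fun=> 3 + s)) //.
rewrite sum_nat_const card_ord /=.
by case: (s) => [|n] //=; rewrite !mulSn ?mulnS ?mulnDr ?mulnDl; nia.
Qed.

(** * Connected graphs with a pure class *)

Lemma iso_complete (H : sgraph) :
  (forall x y : H, x != y -> adj x y) -> iso H (complete_graph #|H|).
Proof.
move=> complH; exists enum_rank; split; first exact: enum_rank_bij.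
move=> x y; rewrite /= /complete_rel (inj_eq enum_rank_inj).
case: (eqVneq x y) => [->|xy]; first by rewrite adj_irr.
by rewrite complH.
Qed.

Lemma deg_gt0 (H : sgraph) (x : H) : connected H -> 1 < #|H| -> 0 < deg x.
Proof.
move=> Hconn /card_gt1P[a [b [_ _ ab]]].
have [y yx] : exists y, y != x.
  by case: (eqVneq a x) => [ax|ax]; [exists b; rewrite -ax eq_sym | exists a].
have [u [v [/set1P-> _ xv]]] : exists u v,
    [/\ u \in [set x], v \notin [set x] & adj u v].
  by apply: connect_exit (Hconn x y) _ _; rewrite !inE.
by apply/card_gt0P; exists v; rewrite inE.
Qed.

(** The third vertex is adjacent to both [a] and [b]. *)
Lemma iso_path3 (H : sgraph) (a b : H) : connected H -> #|H| = 3 ->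
  a != b -> ~~ adj a b -> iso H (path_graph 3).
Proof.
move=> Hconn H3 ab nab.
have H2 : 1 < #|H| by rewrite H3.
have nbr (x y : H) : x != y -> ~~ adj x y -> exists2 c, adj x c & c \notin [:: x; y].
  move=> xy nxy; have /card_gt0P[c] := deg_gt0 x Hconn H2; rewrite inE => xc.
  exists c => //; rewrite !inE negb_or eq_sym adj_neq //.
  by apply: contraNneq nxy => <-.
have [c ac cab] := nbr a b ab nab.
have [d bd dba] : exists2 c, adj b c & c \notin [:: b; a].
  by apply: nbr; [rewrite eq_sym | rewrite adj_sym].
pose g (i : path_graph 3) := nth a [:: a; c; b] i.
have us : uniq [:: a; c; b].
  by move: cab; rewrite /= !inE !negb_or ab andbT (eq_sym a c) => /andP[-> ->].
have g_inj : injective g.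
  by move=> i j /eqP; rewrite nth_uniq ?(ltn_ord _) // => /eqP/val_inj.
have [f fK gK] : bijective g by apply: inj_card_bij; rewrite ?card_ord ?H3.
have cb : adj c b.
  move: bd dba; rewrite -(gK d) adj_sym; case: (f d) => -[|[|[|//]]] i3; rewrite /g //= !inE.
    by rewrite eqxx orbT.
  by rewrite eqxx.
exists f; split; first by exists g.
move=> x y; rewrite -[in RHS](gK x) -[in RHS](gK y).
case: (f x) (f y) => -[|[|[|//]]] i3 [] -[|[|[|//]]] j3;
  by rewrite /g /= /path_rel /= ?adj_irr // ?ac ?cb ?(negbTE nab) // adj_sym ?ac ?cb ?(negbTE nab).
Qed.

Theorem theorem1 (H : sgraph) (H_size : 2 <= #|H|) (H_conn : connected H) :
  pure_Ex H <->
  [\/ iso H (complete_graph 2), iso H (complete_graph 3),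
      iso H (complete_graph 4) | iso H (path_graph 3)].
Proof.
split=> [pureH|]; last first.
  by case=> HK; apply/(pure_iff (fun G => iso_minor G HK));
    [apply: pure_complete.. | apply: pure_path3].
case: (boolp.pselect (forall x y : H, x != y -> adj x y)) => [/iso_complete HK|ncomp].
  have /(pure_iff (fun G => iso_minor G HK)) := pureH.
  case: #|H| H_size HK => [|[|[|[|[|s]]]]] // _ HK pureK.
  - exact: Or41.
  - exact: Or42.
  - exact: Or43.
  - by case: (@not_pure_complete s pureK).
have [a [b [ab nab]]] : exists a b : H, a != b /\ ~~ adj a b.
  apply: boolp.contrapT => none; apply: ncomp => x y xy.
  by apply/negPn/negP => nxy; apply: none; exists x, y.
have [h0 h0min] := @min_degP H (ltnW H_size).
have h0_gt0 := deg_gt0 h0 H_conn H_size.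
have degH : (deg h0).+1 < #|H|.
  apply: leq_ltn_trans (_ : (deg a).+1 < _); first by rewrite ltnS h0min.
  apply: leq_ltn_trans (_ : #|[set~ b]| < _); last first.
    by rewrite cardsC1; case: #|H| H_size.
  apply: (@leq_trans #|a |: [set y | adj a y]|).
    by rewrite cardsU1 inE adj_irr.
  apply/subset_leq_card/subsetP => y; rewrite !inE => /orP[/eqP->//|ay].
  by apply: contraNneq nab => <-.
case: (ltngtP (deg h0) 1) h0_gt0 => [//|d2|d1] _.
- by case: (not_pure_deg2 H_conn h0min d2 degH).
- case: (ltngtP #|H| 3) => [H3|H3|H3].
  + by rewrite d1 in degH; move: degH H3; lia.
  + by case: (not_pure_leaf H_conn d1 H3).
  + by apply: Or44; apply: iso_path3 ab nab.
Qed.
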